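(* Let $K$ be a real biquadratic field. The log-unit lattice $\Lambda_K$ of $K$ is orthogonal if and only if $K$ is of type I.
   Context: A real biquadratic field is $K=\mathbb{Q}(\sqrt{d_1},\sqrt{d_2})$ with $d_1,d_2>0$ rational and none of $d_1,d_2,d_1d_2$ a square in $\mathbb{Q}$. Its Galois group is generated by $\sigma,\tau$ with $\sigma(\sqrt{d_1})=-\sqrt{d_1}$, $\sigma(\sqrt{d_2})=\sqrt{d_2}$, $\tau(\sqrt{d_1})=\sqrt{d_1}$, $\tau(\sqrt{d_2})=-\sqrt{d_2}$. Fix an embedding $K\subset\mathbb{R}$ and define $\mathrm{Log}:K^\times\to\mathbb{R}^4$, $\mathrm{Log}(x)=(\log|x|,\log|\tau(x)|,\log|\sigma(x)|,\log|\sigma\tau(x)|)$; the log-unit lattice is $\Lambda_K=\mathrm{Log}(\mathcal{O}_K^\times)$, of rank 3. Units $u_1,u_2,u_3$ form a system of fundamental units for $K$ if $\mathrm{Log}(u_1),\mathrm{Log}(u_2),\mathrm{Log}(u_3)$ is a basis of $\Lambda_K$. Let $K_1=\mathbb{Q}(\sqrt{d_1})$, $K_2=\mathbb{Q}(\sqrt{d_2})$, $K_3=\mathbb{Q}(\sqrt{d_1d_2})$ and let $\epsilon_i$ be a fundamental unit of $K_i$ (a unit whose image under the analogous Log map of $K_i$ generates the log-unit lattice of $K_i$). Below $\sqrt{\alpha}$ denotes an element of $K$ whose square is $\alpha$. $K$ is of type I if, up to permutation of the indices $1,2,3$, one of (a) $\epsilon_1,\epsilon_2,\epsilon_3$; (b)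 $\sqrt{\epsilon_1},\epsilon_2,\epsilon_3$; (c) $\sqrt{\epsilon_1},\sqrt{\epsilon_2},\epsilon_3$ is a system of fundamental units. (Types II: $\sqrt{\epsilon_1\epsilon_2},\epsilon_2,\epsilon_3$ or $\sqrt{\epsilon_1\epsilon_2},\epsilon_2,\sqrt{\epsilon_3}$ up to permutation; III: $\sqrt{\epsilon_1\epsilon_2},\sqrt{\epsilon_2\epsilon_3},\sqrt{\epsilon_1\epsilon_3}$; IV: $\sqrt{\epsilon_1\epsilon_2\epsilon_3},\epsilon_2,\epsilon_3$.) A lattice is orthogonal if it has a basis of pairwise orthogonal vectors for the standard Euclidean inner product. *)

(* Defs.v *)
From HB Require Import structures.
From mathcomp Require Import all_boot all_order all_algebra all_fingroup all_field.
From mathcomp Require Import boolp classical_sets reals exp.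

Set Implicit Arguments.
Unset Strict Implicit.
Unset Printing Implicit Defensive.

Import Order.TTheory GRing.Theory Num.Theory.
Local Open Scope classical_set_scope.
Local Open Scope ring_scope.

Section Lattices.
Variables (R : realType) (m : nat).

Definition zspan n (B : 'M[R]_(n, m)) : set 'rV[R]_m :=
  [set v | exists z : 'rV[int]_n, v = map_mx intr z *m B].

Definition lattice_basis (L : set 'rV[R]_m) n (B : 'M[R]_(n, m)) : Prop :=
  row_free B /\ L = zspan B.

Definition dotv (u v : 'rV[R]_m) : R := \sum_(k < m) u 0 k * v 0 k.

Definition orthogonal_lattice (L : set 'rV[R]_m) : Prop :=
  exists (n : nat) (B : 'M[R]_(n, m)),
    lattice_basis L B /\
    forall i j : 'I_n, i != j -> dotv (row i B) (row j B) = 0.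

End Lattices.

Section NumberField.
Variable K : splittingFieldType rat.

Definition ring_of_integers (E : {subfield K}) : set K :=
  [set x | x \in E /\ integralOver (intr : int -> K) x].

Definition integer_units (E : {subfield K}) : set K :=
  [set x | ring_of_integers E x /\
           exists2 y, ring_of_integers E y & x * y = 1].

(* K = Q(s1, s2) with s1, s2 square roots of d1, d2; sigma and tau are then
   determined by their values at s1 and s2. *)
Definition real_biquadratic (d1 d2 : rat) (s1 s2 : K)
    (sigma tau : gal_of {:K}) : Prop :=
  [/\ 0 < d1 /\ 0 < d2,
      forall q : rat, [/\ q ^+ 2 != d1, q ^+ 2 != d2 & q ^+ 2 != d1 * d2],
      [/\ s1 ^+ 2 = d1%:A, s2 ^+ 2 = d2%:A & <<<<1; s1>>; s2>>%VS = {:K}%VS],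
      sigma s1 = - s1 /\ sigma s2 = s2
    & tau s1 = s1 /\ tau s2 = - s2].

End NumberField.

Section LogUnitLattice.
Variables (R : realType) (K : splittingFieldType rat).
Variable iota : {rmorphism K -> R}.

Definition Log (sigma tau : gal_of {:K}) (x : K) : 'rV[R]_4 :=
  \row_(i < 4) ln `|iota [:: x; tau x; sigma x; sigma (tau x)]`_i|.

Definition log_unit_lattice (sigma tau : gal_of {:K}) : set 'rV[R]_4 :=
  Log sigma tau @` integer_units {:K}%AS.

Definition fundamental_system (sigma tau : gal_of {:K}) (u1 u2 u3 : K) : Prop :=
  [/\ integer_units {:K}%AS u1, integer_units {:K}%AS u2,
      integer_units {:K}%AS u3
    & lattice_basis (log_unit_lattice sigma tau)
        (\matrix_(i < 3) Log sigma tau [:: u1; u2; u3]`_i)].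

(* The Log map of a quadratic subfield; g is an automorphism of K restricting
   to the nontrivial automorphism of that subfield. *)
Definition quad_Log (g : gal_of {:K}) (x : K) : 'rV[R]_2 :=
  \row_(i < 2) ln `|iota [:: x; g x]`_i|.

Definition fundamental_unit (E : {subfield K}) (g : gal_of {:K}) (e : K) :
    Prop :=
  integer_units E e /\ quad_Log g @` integer_units E = zspan (quad_Log g e).

(* The fundamental units of the three subfields are determined only up to sign
   and inversion. Their choice is part of the definition of the type: the sign
   matters for the existence of a square root in K. The list [:: a; b; c] is
   the list [:: e1; e2; e3] after a permutation of the indices. *)
Definition type_I (s1 s2 : K) (sigma tau : gal_of {:K}) : Prop :=
  exists e1 e2 e3 : K,
    [/\ fundamental_unit <<1; s1>>%AS sigma e1,
        fundamental_unit <<1; s2>>%AS tau e2,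
        fundamental_unit <<1; s1 * s2>>%AS sigma e3
      & exists a b c : K, perm_eq [:: a; b; c] [:: e1; e2; e3] /\
        [\/ fundamental_system sigma tau a b c,
            exists2 r, r ^+ 2 = a & fundamental_system sigma tau r b c
          | exists r t, [/\ r ^+ 2 = a, t ^+ 2 = b
                          & fundamental_system sigma tau r t c]]].

End LogUnitLattice.

(* Main.v *)
Require Import Defs.
From mathcomp Require Import all_boot all_order all_algebra all_fingroup all_field.
From mathcomp Require Import boolp classical_sets reals exp.
From mathcomp Require Import ring lra zify.

(* Write L = Log and let V_k be the line of R^4 spanned by the logarithms of the units of the
   quadratic subfield K_k.  These three lines are orthogonal, and if r^2 is a unit of K_k, then
   L(r) is on V_k too, so the fundamental system of a field of type I is orthogonal.

   Conversely let v_1, ..., v_n be an orthogonal basis of the lattice and let T be the isometric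
   involution induced by an automorphism g.  If T v_i = sum_j c_ij v_j, then C^2 = 1 while
   c_ij |v_j|^2 is symmetric in i and j, so the nonnegative integers c_ij c_ji have sum 1 over j:
   either T v_i = +-v_i or T v_i is orthogonal to v_i.  If p_1, p_2, p_3 are the coordinates of
   v_i on the V_k, this reads "p_k = 0, or the two others vanish, or p_k^2 is the sum of the
   squares of the two others".  As K_k and K_l intersect in Q, p_k^2 = p_l^2 only when both
   vanish, so v_i lies on one of the V_k.  Pell's equation puts a nonzero vector on each V_k and
   orthogonality leaves room for one v_i only, so the lattice has a basis L(w_1), L(w_2), L(w_3)
   with L(w_k) on V_k.  Either L(w_k) is the logarithm of a unit of K_k, or w_k^2 is a
   fundamental unit of K_k.  The latter cannot happen for all three k: it makes w_1 equal to
   x sqrt(d2) + y sqrt(d1 d2), and (w_1 +- sigma(w_1))^2 are integers at distance 4 in the square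
   classes of d2 and d1 d2; the same for w_2 and w_3 shows that no odd prime divides any of the
   three square classes, so that one of them is trivial. *)

Set Implicit Arguments.
Unset Strict Implicit.
Unset Printing Implicit Defensive.

Import Order.TTheory GRing.Theory Num.Theory.
Local Open Scope ring_scope.

(** * Integers at distance 4 and square classes *)

(** Every prime divisor has valuation at least 2, so its square can be divided out, which changes no
    parity. *)
Lemma even_logn_sqr (x : nat) :
  (0 < x)%N -> (forall p, prime p -> ~~ odd (logn p x)) ->
  exists c, x = (c ^ 2)%N.
Proof.
elim/ltn_ind: x => x IH x0 ev.
have [x1|x1] := leqP x 1.
  by exists 1%N; rewrite exp1n; apply/eqP; rewrite eqn_leq x1 x0.
have [p [pp pdvd]] : exists p, prime p /\ (p %| x)%N.
  by exists (pdiv x); rewrite pdiv_prime // pdiv_dvd.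
have lp : (0 < logn p x)%N by rewrite logn_gt0 mem_primes pp x0.
have l2 : (1 < logn p x)%N by have := ev p pp; case: (logn p x) lp => [|[|]].
have /dvdnP[y xy] : (p ^ 2 %| x)%N by rewrite pfactor_dvdn.
have y0 : (0 < y)%N by move: x0; rewrite xy muln_gt0 => /andP[].
have [c yc] : exists c, y = (c ^ 2)%N.
  apply: IH => // [|q qp].
    by rewrite xy -[ltnLHS]muln1 ltn_pmul2l // (ltn_exp2l 0) // prime_gt1.
  have p20 : (0 < p ^ 2)%N by rewrite expn_gt0 prime_gt0.
  by have := ev q qp; rewrite xy (lognM _ y0 p20) (lognX q p 2) oddD oddM addbF.
by exists (c * p)%N; rewrite xy yc expnMn.
Qed.

Lemma even_logn_odd_sqr (x : nat) :
  (0 < x)%N -> (forall p, prime p -> odd p -> ~~ odd (logn p x)) ->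
  exists c, x = (c ^ 2)%N \/ x = (2 * c ^ 2)%N.
Proof.
move=> x0 ev; case o2 : (odd (logn 2 x)); last first.
  have [c ->] : exists c, x = (c ^ 2)%N; last by exists c; left.
  apply: even_logn_sqr => // p pp; have [->|] := eqVneq p 2%N; first by rewrite o2.
  by case: (even_prime pp) => [->//|op _]; apply: ev.
have /dvdnP[y xy] : (2 ^ 1 %| x)%N by rewrite pfactor_dvdn //; case: (logn 2 x) o2.
have y0 : (0 < y)%N by move: x0; rewrite xy muln_gt0 => /andP[].
have [c yc] : exists c, y = (c ^ 2)%N.
  apply: even_logn_sqr => // p pp; have [p2|] := eqVneq p 2%N.
    by move: o2; rewrite xy lognM // lognX oddD p2 /= addbT => /negbTE ->.
  case: (even_prime pp) => [->//|op _]; have := ev p pp op.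
  rewrite xy lognM // lognX mul1n oddD [logn p 2]logn_prime //.
  by case: eqVneq op => [->//|]; rewrite addbF.
by exists c; right; rewrite xy yc mulnC.
Qed.

(** Numerator times denominator is a natural number in the square class of [d]; this makes
    valuations available. *)
Lemma rat_sqr_class (d : rat) :
  0 < d -> exists N q : nat, [/\ (0 < N)%N, (0 < q)%N & d * q%:R ^+ 2 = N%:R].
Proof.
move=> d0; exists (`|numq d| * `|denq d|)%N, `|denq d|%N.
have n0 : 0 < numq d by rewrite numq_gt0.
have dd0 := denq_gt0 d.
split; rewrite ?muln_gt0 ?absz_gt0 ?gt_eqF //.
have -> : (`|denq d|%N)%:R = (denq d)%:~R :> rat.
  by rewrite -[RHS](congr1 intr (gtz0_abs dd0)) .
rewrite natrM.
have -> : (`|denq d|%N)%:R = (denq d)%:~R :> rat.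
  by rewrite -[RHS](congr1 intr (gtz0_abs dd0)) .
have -> : (`|numq d|%N)%:R = (numq d)%:~R :> rat.
  by rewrite -[RHS](congr1 intr (gtz0_abs n0)) .
rewrite -{1}[d]divq_num_den expr2 mulrA divfK // intr_eq0; lia.
Qed.

Lemma odd_logn_sqr_class (x : rat) (m N p : nat) :
  x != 0 -> (0 < N)%N -> m%:R = x ^+ 2 * N%:R -> odd (logn p m) = odd (logn p N).
Proof.
move=> x0 N0 e; have n0 : (0 < `|numq x|)%N by rewrite absz_gt0 numq_eq0.
have dd0 : (0 < `|denq x|)%N by rewrite absz_gt0 denq_neq0.
have e2 : (m * `|denq x| ^ 2 = `|numq x| ^ 2 * N)%N.
  apply/eqP; rewrite -(eqr_nat rat) !natrM -!expr2 e !natr_absz.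
  rewrite !intr_norm !real_normK ?num_real // mulrAC -exprMn.
  by rewrite -{1}[x]divq_num_den divfK // intr_eq0 denq_neq0.
have m0 : (0 < m)%N.
  by rewrite -(ltr_nat rat) e mulr_gt0 ?ltr0n // exprn_even_gt0.
have := congr1 (fun z => odd (logn p z)) e2.
rewrite lognM ?expn_gt0 ?dd0 // [in RHS]lognM ?expn_gt0 ?n0 //.
rewrite (lognX p `|denq x| 2) (lognX p `|numq x| 2).
by rewrite !mul2n !oddD !odd_double addbF.
Qed.

(** A prime of odd valuation in both numbers divides both, hence divides their distance 4. *)
Lemma odd_logn_dist4 (m m' p : nat) : prime p -> odd p ->
  m = (m' + 4)%N \/ m' = (m + 4)%N -> ~~ (odd (logn p m) && odd (logn p m')).
Proof.
move=> pp op h; apply/negP => /andP[o o'].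
have dv z : odd (logn p z) -> (p %| z)%N.
  have [->|z0] := posnP z; first by rewrite dvdn0.
  by move=> ho; rewrite -[p]expn1 pfactor_dvdn //; case: (logn p z) ho.
have : (p %| 2 ^ 2)%N.
  by case: h => e; [rewrite -(dvdn_addr _ (dv _ o'))|rewrite -(dvdn_addr _ (dv _ o))];
    rewrite -e dv.
by rewrite Euclid_dvdX // andbT dvdn_prime2 // => /eqP e; move: op; rewrite e.
Qed.

(** The distance 4 is that of [(u + w) ^+ 2] and [(u - w) ^+ 2] when [u * w] is 1 or -1. Nonzero [x]
    and [y] keep [m] and [m'] in the square classes of [a] and [b]. *)
Definition near4 (a b : rat) := exists x y : rat, exists m m' : nat,
  [/\ x != 0 /\ y != 0, m%:R = x ^+ 2 * a, m'%:R = y ^+ 2 * b &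
      m = (m' + 4)%N \/ m' = (m + 4)%N].

(** At an odd prime no two of [N1], [N2], [N1 * N2] have odd valuation, and the third valuation is
    the sum of the first two, so all are even. Thus [N1] and [N2] are squares or twice squares, and
    if neither is a square, their product is one. *)
Lemma near4_sqr_classes (d1 d2 : rat) : 0 < d1 -> 0 < d2 ->
  (forall q : rat, [/\ q ^+ 2 != d1, q ^+ 2 != d2 & q ^+ 2 != d1 * d2]) ->
  near4 d2 (d1 * d2) -> near4 d1 (d1 * d2) -> near4 d1 d2 -> False.
Proof.
move=> d10 d20 nsq n23 n13 n12.
have [N1 [q1 [N10 q10 e1]]] := rat_sqr_class d10.
have [N2 [q2 [N20 q20 e2]]] := rat_sqr_class d20.
have q1u : q1%:R != 0 :> rat by rewrite pnatr_eq0 -lt0n.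
have q2u : q2%:R != 0 :> rat by rewrite pnatr_eq0 -lt0n.
have d1E : d1 = N1%:R / q1%:R ^+ 2 by rewrite -e1 mulfK // expf_neq0.
have d2E : d2 = N2%:R / q2%:R ^+ 2 by rewrite -e2 mulfK // expf_neq0.
have near p (a b : rat) A B (qa qb : rat) : qa != 0 -> qb != 0 -> (0 < A)%N -> (0 < B)%N ->
    a = A%:R / qa ^+ 2 -> b = B%:R / qb ^+ 2 -> prime p -> odd p ->
    near4 a b -> ~~ (odd (logn p A) && odd (logn p B)).
  move=> qa0 qb0 A0 B0 aE bE pp op [x [y [m [m' [[x0 y0] em em' h]]]]].
  have xq : x / qa != 0 by rewrite mulf_neq0 ?invr_eq0.
  have yq : y / qb != 0 by rewrite mulf_neq0 ?invr_eq0.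
  rewrite -(@odd_logn_sqr_class (x / qa) m A) //; last by rewrite em aE expr_div_n mulrA mulrAC.
  rewrite -(@odd_logn_sqr_class (y / qb) m' B) //; last by rewrite em' bE expr_div_n mulrA mulrAC.
  exact: odd_logn_dist4.
have d3E : d1 * d2 = (N1 * N2)%:R / (q1%:R * q2%:R) ^+ 2.
  by rewrite d1E d2E natrM; field; rewrite q1u q2u.
have N30 : (0 < N1 * N2)%N by rewrite muln_gt0 N10.
have q3u : q1%:R * q2%:R != 0 :> rat by rewrite mulf_neq0.
have par p : prime p -> odd p -> ~~ odd (logn p N1) /\ ~~ odd (logn p N2).
  move=> pp op; have := near p _ _ _ _ _ _ q2u q3u N20 N30 d2E d3E pp op n23.
  have := near p _ _ _ _ _ _ q1u q3u N10 N30 d1E d3E pp op n13.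
  have := near p _ _ _ _ _ _ q1u q2u N10 N20 d1E d2E pp op n12.
  by rewrite lognM // oddD; case: (odd _); case: (odd _).
have [c1 h1] := even_logn_odd_sqr N10 (fun p pp op => proj1 (par p pp op)).
have [c2 h2] := even_logn_odd_sqr N20 (fun p pp op => proj2 (par p pp op)).
case: h1 => h1.
  have [/eqP[]] := nsq (c1%:R / q1%:R); by rewrite d1E h1 natrX expr_div_n.
case: h2 => h2.
  have [_ /eqP[]] := nsq (c2%:R / q2%:R); by rewrite d2E h2 natrX expr_div_n.
have [_ _ /eqP[]] := nsq (2 * c1%:R * c2%:R / (q1%:R * q2%:R)).
by rewrite d3E h1 h2 !natrM; field; rewrite q1u q2u.
Qed.

(** * Pell's equation *)

Lemma pigeonhole (A B : finType) (f : A -> B) :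
  (#|B| < #|A|)%N -> exists x y, x != y /\ f x = f y.
Proof.
move=> h; apply: contrapT => hn; move: h; rewrite ltnNge => /negP[].
apply: (leq_card f) => x y e; apply/eqP/negPn/negP => xy; apply: hn.
by exists x, y.
Qed.

(** Among the fractional parts of [i * r] for [i] from 0 to [N], two share one of [N] intervals of
    length [1 / N]; their difference gives [a] and [b]. *)
Lemma dirichlet_approx (R : realType) (r : R) (N : nat) : (0 < N)%N ->
  exists (a : int) (b : nat), (0 < b <= N)%N /\ N%:R * `|a%:~R - b%:R * r| < 1.
Proof.
case: N => // N _.
pose fr (i : nat) : R := i%:R * r - (Num.floor (i%:R * r))%:~R.
have fr0 i : 0 <= fr i by rewrite subr_ge0 floor_le.
have fr1 i : fr i < 1 by rewrite ltrBlDl -[1]/(1%:~R) -intrD floorD1_gt.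
pose f (i : 'I_N.+2) : 'I_N.+1 := inord (Num.truncn (N.+1%:R * fr i)).
have [i [j [ij /(congr1 val)]]] : exists i j, i != j /\ f i = f j.
  by apply: pigeonhole; rewrite !card_ord.
have N0 : 0 < N.+1%:R :> R by rewrite ltr0n.
have fE k : ((f k : nat)%:R <= N.+1%:R * fr k < (f k).+1%:R).
  rewrite /f /= inordK.
    by apply: truncn_itv; rewrite mulr_ge0 ?ler0n.
  rewrite truncn_lt_nat ?mulr_ge0 ?ler0n //.
  by rewrite -[ltRHS]mulr1 ltr_pM2l.
wlog ltij : i j ij / (i < j)%N.
  move=> W; have [|ji|/val_inj e] := ltngtP i j; first exact: W.
    by move=> e; apply: (W j i) => //; rewrite eq_sym.
  by rewrite e eqxx in ij.
move=> e; have /andP[i1 i2] := fE i; have /andP[j1 j2] := fE j.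
exists (Num.floor (j%:R * r) - Num.floor (i%:R * r)), (j - i)%N; split.
  by have := ltn_ord j; lia.
rewrite intrB natrB 1?ltnW // -[N.+1%:R]gtr0_norm // -normrM ltr_norml.
rewrite -[_ - _ - _](_ : fr i - fr j = _); last by rewrite /fr; ring.
rewrite /= in e; rewrite e -natr1 in i1 i2; rewrite -natr1 in j2.
by rewrite mulrBr; apply/andP; split; lra.
Qed.

(** From [a ^+ 2 = D * b ^+ 2] it follows that [b] divides [a], and the square of the quotient is
    [D]. *)
Lemma nonsquare_normform (D : nat) (a b : int) :
  (forall c : nat, (c ^ 2)%N <> D) -> b != 0 -> a ^+ 2 - D%:R * b ^+ 2 != 0.
Proof.
move=> nsq b0; apply/eqP => e.
have e2 : (`|a| ^ 2 = D * `|b| ^ 2)%N.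
  have : `|(a ^+ 2)%R|%N = `|(D%:R * b ^+ 2)%R|%N :> nat.
    by congr absz; apply/eqP; rewrite -subr_eq0 e.
  by rewrite abszM !abszX natz absz_nat.
have /dvdnP[c ac] : (`|b| %| `|a|)%N by rewrite -(@dvdn_pexp2r _ _ 2) // e2 dvdn_mull.
apply: (nsq c); move: e2; rewrite ac expnMn => /eqP.
by rewrite eqn_pmul2r ?expn_gt0 ?absz_gt0 ?b0 // => /eqP.
Qed.

Lemma pell (R : realType) (D : nat) : (forall c : nat, (c ^ 2)%N <> D) ->
  exists x y : int, y != 0 /\ x ^+ 2 - D%:R * y ^+ 2 = 1.
Proof.
move=> nsq; pose r : R := Num.sqrt D%:R.
have r2 : r ^+ 2 = D%:R by rewrite sqr_sqrtr // ler0n.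
have r0 : 0 <= r by rewrite sqrtr_ge0.
pose nm (x : int * int) : int := x.1 ^+ 2 - D%:R * x.2 ^+ 2.
pose dist (x : int * int) : R := `|x.1%:~R - x.2%:~R * r|.
have nmE x : (nm x)%:~R = (x.1%:~R - x.2%:~R * r) * (x.1%:~R + x.2%:~R * r) :> R.
  rewrite /nm intrB intrM !rmorphXn /=.
  have -> : (D%:R : int)%:~R = D%:R :> R by rewrite natz.
  by rewrite -r2; ring.
have dist_gt0 x : x.2 != 0 -> 0 < dist x.
  move=> x0; rewrite normr_gt0; apply/eqP => e.
  have := nonsquare_normform x.1 nsq x0; rewrite -/(nm x).
  by rewrite -(intr_eq0 R) nmE e mul0r eqxx.
(* If [|a - b * r| < 1 / N] and [b <= N], then [|a + b * r| <= 1 + 2 * N * r], and the product of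
   the two is at most [1 + 2 * r]. *)
pose M := Num.truncn (1 + 2 * r).
have step (x : int * int) : exists y : int * int,
    x.2 != 0 -> [/\ 0 < y.2, dist y < dist x & (`|nm y| <= M)%N].
  have [x0|x0] := eqVneq x.2 0; first by exists x.
  (* This [N] exceeds the inverse of [dist x], so the approximation obtained is strictly closer than
     [x]. *)
  pose N := (Num.truncn (dist x)^-1).+1.
  have [a [b [/andP[b0 bN] ab]]] := @dirichlet_approx R r N isT.
  have N0 : 0 < N%:R :> R by rewrite ltr0n.
  have dx := dist_gt0 x x0.

  have ab1 : `|a%:~R - b%:R * r| < N%:R^-1 by rewrite -[ltRHS]mulr1 ltr_pdivlMl.
  have bz : (b%:Z)%:~R = b%:R :> R by [].
  exists (a, b%:Z) => _; split => //=.
    rewrite /dist /= bz; apply: (lt_trans ab1); rewrite invf_plt ?posrE //.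
    by have /andP[_] := truncn_itv (ltW (etrans (invr_gt0 (dist x)) dx)).
  rewrite truncn_ge_nat; last by lra.
  rewrite natr_absz intr_norm nmE /= bz normrM.
  have bN' : b%:R <= N%:R :> R by rewrite ler_nat.
  have N1 : 1 <= N%:R :> R by rewrite ler1n.
  have h2 : `|a%:~R + b%:R * r| <= `|a%:~R - b%:R * r| + 2 * (N%:R * r).
    rewrite [X in `|X|](_ : _ = (a%:~R - b%:R * r) + 2 * (b%:R * r)); last by ring.
    rewrite (le_trans (ler_normD _ _)) // lerD2l ger0_norm ?mulr_ge0 //.
    by rewrite ler_pM2l // ler_wpM2r.
  apply: (@le_trans _ _ (`|a%:~R - b%:R * r| * (1 + 2 * (N%:R * r)))).
    apply: ler_wpM2l => //; apply: (le_trans h2); rewrite lerD2r.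
    by rewrite (le_trans (ltW ab1)) // invf_le1.
  have := normr_ge0 (a%:~R - b%:R * r); nra.
have [F hF] := choice step.
pose s k := iter k F (0, 1).
have s0 k : (s k).2 != 0.
  by elim: k => // k /hF [+ _ _]; rewrite /s /=; case: ltgtP.
have sdec i j : (i < j)%N -> dist (s j) < dist (s i).
  elim: j => // j IH; rewrite ltnS leq_eqVlt => /predU1P[->|/IH].
    by have [] := hF _ (s0 j).
  by apply: lt_trans; have [] := hF _ (s0 j).
(* The factorial is a multiple of every nonzero norm of absolute value at most [M], so congruence
   modulo [Q] gives congruence modulo the common norm. Adding [M] makes the norms natural numbers up
   to [2 * M]. The indices below start at 1 because the seed [(0, 1)] need not satisfy the norm
   bound. *)
pose Q := (M.+1)`!.
have Q0 : (0 < Q)%N by rewrite fact_gt0.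
have QP := prednK Q0.
pose f (x : int * int) : 'I_M.*2.+1 * 'I_Q.-1.+1 * 'I_Q.-1.+1 :=
  (inord `|(nm x + M%:Z)%R|%N, inord `|(x.1 %% Q)%Z|%N, inord `|(x.2 %% Q)%Z|%N).
have [i [j [ij fij]]] : exists i j : 'I_((M.*2.+1 * Q * Q).+1),
    i != j /\ f (s i.+1) = f (s j.+1).
  by apply: pigeonhole; rewrite !card_prod !card_ord !QP.
wlog ltij : i j ij fij / (i < j)%N.
  move=> W; have [|ji|/val_inj e] := ltngtP i j; first exact: W.
    by apply: (W j i) => //; rewrite eq_sym.
  by rewrite e eqxx in ij.
have := sdec i.+1 j.+1 ltij.
have [pa _ la] := hF _ (s0 i); have [pb _ lb] := hF _ (s0 j).
rewrite -[F _]/(s i.+1) in pa la; rewrite -[F _]/(s j.+1) in pb lb.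
move: (s i.+1) (s j.+1) fij pa pb la lb => x y [].
move=> /(congr1 (@nat_of_ord _)) e1 /(congr1 (@nat_of_ord _)) e2.
move=> /(congr1 (@nat_of_ord _)) e3 pa pb la lb dxy.
have modlt z : (`|(z %% Q)%Z|%N < Q.-1.+1)%N.
  by rewrite QP -ltz_nat gez0_abs ?modz_ge0 ?ltz_pmod // eqz_nat -lt0n.
have modge z : 0 <= (z %% Q)%Z by rewrite modz_ge0 // eqz_nat -lt0n.
move: e2 e3; rewrite !inordK // => e2 e3.
have n0 : nm x != 0 by apply: nonsquare_normform => //; rewrite gt_eqF.
have nlt (z : int) : (`|z| <= M)%N -> (`|(z + M%:Z)%R| < M.*2.+1)%N by lia.
have nn : nm y = nm x.
  move: e1; rewrite !inordK ?nlt //.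
  by move: (nm x) (nm y) la lb => a b; lia.
have nQ : (nm x %| Q%:Z)%Z.
  by rewrite /Q dvdzE absz_nat dvdn_fact // absz_gt0 n0 /= leqW.
have c1 : (nm x %| y.1 - x.1)%Z.
  apply: (dvdz_trans nQ); rewrite -eqz_mod_dvd; apply/eqP.
  by rewrite -(gez0_abs (modge y.1)) -e2 gez0_abs.
have c2 : (nm x %| y.2 - x.2)%Z.
  apply: (dvdz_trans nQ); rewrite -eqz_mod_dvd; apply/eqP.
  by rewrite -(gez0_abs (modge y.2)) -e3 gez0_abs.
case/dvdzP: c1 => t et; case/dvdzP: c2 => w ew.
have ey1 : y.1 = x.1 + t * nm x by rewrite -et addrC subrK.
have ey2 : y.2 = x.2 + w * nm x by rewrite -ew addrC subrK.
(* These are the coordinates of [(y.1 + y.2 * r) * (x.1 - x.2 * r) / nm x], a quotient of two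
   elements of equal norm. *)
exists (1 + x.1 * t - D%:R * x.2 * w), (x.1 * w - x.2 * t); split; last first.
  apply: (@mulfI _ (nm x ^+ 2)); first by rewrite expf_neq0.
  rewrite mulr1 [RHS]expr2 -{2}nn /nm ey1 ey2 /nm; ring.
(* A zero second coordinate would make [x] and [y] proportional; with equal norms and positive
   second coordinates they would coincide, against [dxy]. *)
apply/eqP => e.
have xy : x.1 * y.2 = x.2 * y.1 by rewrite ey1 ey2 !mulrDr [x.1 * x.2]mulrC !mulrA (subr0_eq e).
have e4 : nm y * x.2 ^+ 2 = nm x * y.2 ^+ 2.
  rewrite /nm !mulrBl -!exprMn; congr (_ - _); last by ring.
  by rewrite [y.1 * _]mulrC -xy.
move: e4; rewrite nn => /(mulfI n0) /eqP; rewrite eqrXn2 ?ltW // => /eqP e5.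
have yn0 : y.2 != 0 by rewrite gt_eqF.
move: xy; rewrite e5 mulrC => /(mulfI yn0) e6.
by move: dxy; rewrite /dist e5 e6 ltxx.
Qed.

(** * Orthogonal lattices with an involution *)

Section DotProduct.
Variables (R : realType) (m : nat).
Implicit Types u v : 'rV[R]_m.

Lemma dotvE u v : (u *m v^T) 0 0 = dotv u v.
Proof. by rewrite mxE; apply: eq_bigr => k _; rewrite mxE. Qed.

Lemma dotvC u v : dotv u v = dotv v u.
Proof. by apply: eq_bigr => k _; rewrite mulrC. Qed.

Lemma dotvZl a u v : dotv (a *: u) v = a * dotv u v.
Proof. by rewrite -!dotvE -scalemxAl mxE. Qed.

Lemma dotv_suml (I : finType) (F : I -> 'rV[R]_m) v :
  dotv (\sum_i F i) v = \sum_i dotv (F i) v.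
Proof.
by rewrite -dotvE mulmx_suml summxE; apply: eq_bigr => i _; rewrite dotvE.
Qed.

Lemma dotv_gt0 u : u != 0 -> 0 < dotv u u.
Proof.
move=> u0; rewrite lt_neqAle sumr_ge0 ?andbT; last first.
  by move=> k _; rewrite -expr2 sqr_ge0.
apply: contraNneq u0 => /esym /eqP.
rewrite psumr_eq0 => [/allP h|k _]; last by rewrite -expr2 sqr_ge0.
apply/eqP/rowP => k; apply/eqP; rewrite mxE.
by have := h k (mem_index_enum k); rewrite /= mulf_eq0 orbb.
Qed.

Lemma row_free_row_neq0 n (B : 'M[R]_(n, m)) i : row_free B -> row i B != 0.
Proof.
move=> fB; apply/eqP; rewrite rowE -(mul0mx 1 B) => /(row_free_inj fB).
by move/rowP/(_ i)/eqP; rewrite !mxE !eqxx oner_eq0.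
Qed.

(* With [row i B *m T = \sum_j C i j *: row j B], the integer matrix [C] satisfies
   [C ^+ 2 = 1], and [C i j * |b_j|^2] is symmetric in [i, j]; so the products
   [C i j * C j i] are nonnegative integers of sum 1 over [j]. *)
Lemma orthogonal_basis_involution n (B : 'M[R]_(n, m)) (T : 'M[R]_m) :
  row_free B -> (forall i j, i != j -> dotv (row i B) (row j B) = 0) ->
  T^T = T -> T *m T = 1%:M ->
  (forall i, zspan B (row i B *m T)) ->
  forall i, [\/ dotv (row i B) (row i B *m T) = 0,
                row i B *m T = row i B | row i B *m T = - row i B].
Proof.
move=> fB oB Ts TT hz i.
have [C hC] := choice hz.
pose c i j : int := C i 0 j.
have TE k : row k B *m T = \sum_j (c k j)%:~R *: row j B.
  rewrite hC mulmx_sum_row; apply: eq_bigr => j _; by rewrite mxE.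
pose N k := dotv (row k B) (row k B).
have N0 k : 0 < N k by apply: dotv_gt0; apply: row_free_row_neq0.
have dTE k l : dotv (row k B *m T) (row l B) = (c k l)%:~R * N l.
  rewrite TE dotv_suml (bigD1 l) //= dotvZl big1 ?addr0 // => j jl.
  by rewrite dotvZl oB // mulr0.
have sym k l : (c k l)%:~R * N l = (c l k)%:~R * N k.
  rewrite -!dTE [RHS]dotvC -!dotvE trmx_mul Ts -mulmxA //.
have CC : \matrix_(k, l) c k l *m \matrix_(k, l) c k l = 1%:M.
  pose D : 'M[R]_n := map_mx intr (\matrix_(k, l) c k l).
  have DB : D *m B = B *m T.
    by apply/row_matrixP => k; rewrite !row_mul hC; congr (_ *m _);
      apply/rowP => l; rewrite !mxE.
  have : D *m D *m B = 1%:M *m B by rewrite -mulmxA DB mulmxA DB -mulmxA TT mulmx1 mul1mx.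
  move/(row_free_inj fB); rewrite -map_mxM -[1%:M](map_mx1 (intr : int -> R)) /=.
  by move=> /matrixP h; apply/matrixP => k l; have := h k l; rewrite [LHS]mxE [RHS]mxE => /intr_inj.
have sum1 : \sum_j c i j * c j i = 1.
  have /matrixP/(_ i i) := CC; rewrite [RHS]mxE eqxx /= => e.
  by rewrite -[RHS]e mxE; apply: eq_bigr => j _; rewrite !mxE.
have sqE j : (c i j)%:~R ^+ 2 * N j = (c i j * c j i)%:~R * N i.
  by rewrite expr2 -mulrA sym mulrA intrM.
have ge0 j : 0 <= c i j * c j i.
  rewrite -(ler0z R) -(pmulr_lge0 _ (N0 i)) -sqE mulr_ge0 ?sqr_ge0 //.
  exact: ltW.
have [cii|cii] := eqVneq (c i i) 0.
  by apply: Or31; rewrite dotvC dTE cii mul0r.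
(* A nonzero diagonal entry already contributes 1 to the sum, so the other products vanish, and by
   [sqE] the other entries of the row do too. *)
have le1 : 1 <= c i i * c i i.
  by rewrite -gtz0_ge1 lt0r mulf_neq0 //= ge0.
have rest0 : \sum_(j | j != i) c i j * c j i = 0.
  apply/eqP; rewrite eq_le sumr_ge0 ?andbT //.
  by rewrite -(lerD2l (c i i * c i i)) addr0; move: sum1; rewrite (bigD1 i) //= => ->.
have off j : j != i -> c i j = 0.
  move=> ji; have /eqP := rest0; rewrite psumr_eq0 // => /allP /(_ j (mem_index_enum _)).
  rewrite ji /= => /eqP e; have := sqE j; rewrite e mul0r => /eqP.
  by rewrite mulf_eq0 expf_eq0 /= (gt_eqF (N0 j)) orbF intr_eq0 => /eqP.
have vE : row i B *m T = (c i i)%:~R *: row i B.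
  rewrite TE (bigD1 i) //= big1 ?addr0 // => j ji.
  by rewrite off // scale0r.
have : (c i i == 1) || (c i i == -1).
  rewrite -sqrf_eq1 expr2; move: sum1; rewrite (bigD1 i) //= rest0 addr0.
  by move=> ->.
by case/orP => /eqP e; rewrite vE e; [apply: Or32|apply: Or33];
  rewrite ?scale1r // scaleN1r.
Qed.
End DotProduct.

(** * Units of a biquadratic field *)

(** Since [s ^+ 2] lies in [E], each power of [s] reduces to degree at most 1. *)
Lemma Fadjoin_sqrtP (F : fieldType) (L : fieldExtType F) (E : {subfield L}) (s v : L) :
  s ^+ 2 \in E -> v \in <<E; s>>%VS ->
  exists a b, [/\ a \in E, b \in E & v = a + b * s].
Proof.
move=> sE /Fadjoin_polyP[p /polyOverP pE ->]; rewrite horner_coef.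
elim/big_rec: _ => [|i x _ [a [b [aE bE ->]]]].
  by exists 0, 0; rewrite !mem0v mul0r addr0.
suff [a' [b' [a'E b'E ->]]] :
    exists a b, [/\ a \in E, b \in E & p`_i * s ^+ i = a + b * s].
  by exists (a' + a), (b' + b); rewrite !rpredD //; split=> //; ring.
elim: (nat_of_ord i) p`_i (pE i) => [|k IH] c cE.
  by exists c, 0; rewrite mem0v expr0 mulr1 mul0r addr0.
have [a' [b' [a'E b'E e]]] := IH c cE.
exists (b' * s ^+ 2), a'; split=> //; first by rewrite rpredM.
by rewrite exprSr mulrA e; ring.
Qed.

(** The monic polynomial is carried over to [algC], where a rational algebraic integer is an
    integer. *)
Lemma integral_rat_int (K : fieldExtType rat) (q : rat) :
  integralOver (intr : int -> K) q%:A -> exists z : int, q = z%:~R.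
Proof.
case=> p pm pr.
have pq : root (map_poly intr p) q.
  move: pr; rewrite -[_%:A]/(in_alg K q).
  have -> : map_poly (intr : int -> K) p = map_poly (in_alg K) (map_poly intr p).
    by rewrite -map_poly_comp; apply: eq_map_poly => z; rewrite /= -(rmorph_int (in_alg K)).
  by rewrite fmorph_root.
have qA : (ratr q : algC) \in Aint.
  apply: (@root_monic_Aint (map_poly ratr (map_poly intr p))).
  - by rewrite fmorph_root.
  - by rewrite map_monic monic_map.
  - rewrite -map_poly_comp; apply/polyOverP => i; rewrite coef_map_id0 /= ?rmorph0 //.
    by rewrite ratr_int intr_int.
have /intrP[z ez] := Cint_rat_Aint (Crat_rat q) qA.
by exists z; apply/(@fmorph_inj _ _ (ratr : rat -> algC))/(etrans ez); rewrite /= ratr_int.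
Qed.

Lemma half_double (V : lmodType rat) (y : V) : 2^-1 *: (y + y) = y.
Proof. by rewrite -mulr2n -scaler_nat scalerA mulVf // scale1r. Qed.

Section Units.
Variable K : splittingFieldType rat.
Implicit Types (E : {subfield K}) (x y : K) (g : gal_of {:K}).

Lemma galQ g (a : rat) : g a%:A = a%:A.
Proof. by rewrite linearZ /= rmorph1. Qed.

Lemma integral_gal g x :
  integralOver (intr : int -> K) x -> integralOver (intr : int -> K) (g x).
Proof.
case=> p pm pr; exists p => //.
have -> : map_poly (intr : int -> K) p = map_poly g (map_poly intr p).
  by rewrite -map_poly_comp; apply: eq_map_poly => z /=; rewrite rmorph_int.
by rewrite fmorph_root.
Qed.

Lemma integer_units_neq0 E x : integer_units E x -> x != 0.
Proof.
by move=> [_ [y _ e]]; apply/eqP => x0; move: e; rewrite x0 mul0r => /esym/eqP; rewrite oner_eq0.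
Qed.

Lemma integer_units1 E : integer_units E 1.
Proof.
have r1 : ring_of_integers E 1 by split; [exact: mem1v|exact: integral1].
by split=> //; exists 1; rewrite ?mulr1.
Qed.

Lemma integer_unitsM E x y :
  integer_units E x -> integer_units E y -> integer_units E (x * y).
Proof.
have rM a b : ring_of_integers E a -> ring_of_integers E b ->
    ring_of_integers E (a * b).
  by move=> [aE aI] [bE bI]; split; [exact: rpredM|exact: integral_mul].
move=> [xE [x' x'E xx']] [yE [y' y'E yy']]; split; first exact: rM.
by exists (x' * y'); [exact: rM|rewrite mulrACA xx' yy' mulr1].
Qed.

Lemma integer_unitsV E x : integer_units E x -> integer_units E x^-1.
Proof.
move=> ux; have x0 := integer_units_neq0 ux; move: ux => [xE [y yE xy]].
have -> : x^-1 = y by apply: (mulfI x0); rewrite mulfV.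
by split=> //; exists x => //; rewrite mulrC.
Qed.

Lemma integer_unitsX E x n : integer_units E x -> integer_units E (x ^+ n).
Proof.
move=> ux; elim: n => [|n IH]; first by rewrite expr0; exact: integer_units1.
by rewrite exprS; exact: integer_unitsM.
Qed.

Lemma integer_unitsXz E x (z : int) : integer_units E x -> integer_units E (x ^ z).
Proof.
case: z => n ux; first exact: integer_unitsX.
by apply: integer_unitsV; apply: integer_unitsX.
Qed.

Lemma integer_units_gal g x :
  integer_units {:K}%AS x -> integer_units {:K}%AS (g x).
Proof.
have rg a : ring_of_integers {:K}%AS a -> ring_of_integers {:K}%AS (g a).
  by move=> [_ aI]; split; [exact: memvf|exact: integral_gal].
move=> [xE [y yE xy]]; split; first exact: rg.
by exists (g y); [exact: rg|rewrite -rmorphM xy rmorph1].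
Qed.

(** The inverse of an element of [E] stays in [E]; units of subfields can thus be treated inside
    [K]. *)
Lemma integer_unitsT E x :
  integer_units E x <-> integer_units {:K}%AS x /\ x \in E.
Proof.
split=> [ux|[ux xE]].
  move: ux => [[xE xI] [y [yE yI] xy]]; split=> //; split; first by split=> //; exact: memvf.
  by exists y => //; split=> //; exact: memvf.
have x0 := integer_units_neq0 ux; move: ux => [[_ xI] [y [_ yI] xy]].
split=> //; exists y => //; split=> //.
have -> : y = x^-1 by apply: (mulfI x0); rewrite mulfV.
by rewrite rpredV.
Qed.

Lemma rational_unit (q : rat) :
  integer_units {:K}%AS q%:A -> (q%:A : K) = 1 \/ (q%:A : K) = -1.
Proof.
move=> uq; have uV := integer_unitsV uq.
have [[_ qI] _] := uq; have [[_ qVI] _] := uV.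
have [z ez] := integral_rat_int qI.
have [w ew] : exists w : int, q^-1 = w%:~R.
  by apply: (@integral_rat_int K); rewrite -[_%:A]/(in_alg K _) fmorphV.
have q0 : q != 0.
  by apply/eqP => q0; have := integer_units_neq0 uq; rewrite q0 scale0r eqxx.
have zw : z * w = 1.
  by apply: (@intr_inj rat); rewrite intrM -ez -ew mulfV.
have : (z == 1) || (z == -1).
  have : (`|z| * `|w|)%N = 1%N by rewrite -abszM zw.
  by move/eqP; rewrite muln_eq1 => /andP[/eqP z1 _]; lia.
by case/orP => /eqP z1; [left|right]; rewrite ez z1 ?rmorphN1 ?scaleN1r // scale1r.
Qed.

End Units.

(** * Coordinates on 1, [s1], [s2], [s1 * s2] and the fixed elements of the automorphisms *)

Section Biquadratic.
Variables (K : splittingFieldType rat) (d1 d2 : rat) (s1 s2 : K).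
Variables (sigma tau : gal_of {:K}).
Hypothesis hK : real_biquadratic d1 d2 s1 s2 sigma tau.
Implicit Types x : K.


Let comb (a b c d : rat) : K := a%:A + b%:A * s1 + c%:A * s2 + d%:A * (s1 * s2).

Lemma biquadratic_repr x : exists a b c d : rat,
  x = a%:A + b%:A * s1 + c%:A * s2 + d%:A * (s1 * s2).
Proof.
case: hK => _ _ [e1 e2 eK] _ _.
have : x \in <<<<1; s1>>%AS; s2>>%VS by rewrite /= eK memvf.
case/Fadjoin_sqrtP => [|u [v [uE vE ->]]].
  by rewrite e2 rpredZ // mem1v.
have s1E : s1 ^+ 2 \in (1%AS : {subfield K}) by rewrite e1 rpredZ // mem1v.
have [a [b [/vlineP[a' ->] /vlineP[b' ->] ->]]] := Fadjoin_sqrtP s1E uE.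
have [c [d [/vlineP[c' ->] /vlineP[d' ->] ->]]] := Fadjoin_sqrtP s1E vE.
by exists a', b', c', d'; ring.
Qed.

Let sigmaE a b c d : sigma (comb a b c d) = comb a (- b) c (- d).
Proof.
case: hK => _ _ _ [g1 g2] _.
by rewrite /comb !rmorphD !rmorphM /= !galQ g1 g2 !scaleNr; ring.
Qed.

Let tauE a b c d : tau (comb a b c d) = comb a b (- c) (- d).
Proof.
case: hK => _ _ _ _ [g1 g2].
by rewrite /comb !rmorphD !rmorphM /= !galQ g1 g2 !scaleNr; ring.
Qed.

Lemma sigmaK x : sigma (sigma x) = x.
Proof.
have [a [b [c [d ->]]]] := biquadratic_repr x.
by rewrite -/(comb a b c d) !sigmaE !opprK.
Qed.

Lemma tauK x : tau (tau x) = x.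
Proof.
have [a [b [c [d ->]]]] := biquadratic_repr x.
by rewrite -/(comb a b c d) !tauE !opprK.
Qed.

Lemma tau_sigma x : tau (sigma x) = sigma (tau x).
Proof.
have [a [b [c [d ->]]]] := biquadratic_repr x.
by rewrite -/(comb a b c d) sigmaE !tauE sigmaE.
Qed.

Lemma fixed_tau x : tau x = x -> x \in <<1; s1>>%VS.
Proof.
have [a [b [c [d ->]]]] := biquadratic_repr x.
(* [x] is the mean of itself and its image, where the coordinates negated by [tau] cancel; no
   comparison of coordinates is made. *)
rewrite -/(comb a b c d) tauE => e; rewrite -[comb a b c d]half_double -{2}e.
have -> : comb a b c d + comb a b (- c) (- d) = 2 *: (a%:A + b *: s1).
  by rewrite scaler_nat /comb !scaleNr -(mulr_algl b s1); ring.
by rewrite scalerA mulVf // scale1r rpredD // rpredZ ?memv_adjoin // rpred1.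
Qed.

Lemma fixed_sigma x : sigma x = x -> x \in <<1; s2>>%VS.
Proof.
have [a [b [c [d ->]]]] := biquadratic_repr x.
rewrite -/(comb a b c d) sigmaE => e; rewrite -[comb a b c d]half_double -{2}e.
have -> : comb a b c d + comb a (- b) c (- d) = 2 *: (a%:A + c *: s2).
  by rewrite scaler_nat /comb !scaleNr -(mulr_algl c s2); ring.
by rewrite scalerA mulVf // scale1r rpredD // rpredZ ?memv_adjoin // rpred1.
Qed.

Lemma fixed_sigma_tau x : sigma (tau x) = x -> x \in <<1; s1 * s2>>%VS.
Proof.
have [a [b [c [d ->]]]] := biquadratic_repr x.
rewrite -/(comb a b c d) tauE sigmaE !opprK => e.
rewrite -[comb a b c d]half_double -{2}e.
have -> : comb a b c d + comb a (- b) (- c) d = 2 *: (a%:A + d *: (s1 * s2)).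
  by rewrite scaler_nat /comb !scaleNr -(mulr_algl d (s1 * s2)); ring.
by rewrite scalerA mulVf // scale1r rpredD // rpredZ ?memv_adjoin // rpred1.
Qed.

(** The four conjugates coincide, and their sum is four times the rational coordinate. *)
Lemma fixed_rational x : tau x = x -> sigma x = x -> exists q : rat, x = q%:A.
Proof.
have [a [b [c [d ->]]]] := biquadratic_repr x.
rewrite -/(comb a b c d) tauE sigmaE => et es; exists a.
have e3 : comb a (- b) (- c) d = comb a b c d.
  by have := congr1 sigma et; rewrite !sigmaE opprK es.
have : comb a b c d *+ 4 = a%:A *+ 4.
  rewrite (_ : _ *+ 4 = comb a b c d + comb a b (- c) (- d) + comb a (- b) c (- d)
     + comb a (- b) (- c) d); last by rewrite et es e3; ring.
  by rewrite /comb !scaleNr; ring.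
have inj4 (u v : K) : u *+ 4 = v *+ 4 -> u = v.
  move/(congr1 ( *:%R (4^-1 : rat))).
  by rewrite -!scaler_nat !scalerA mulVf // !scale1r.
exact: inj4.
Qed.

Lemma antifixed_tau x : tau x = - x -> exists a b : rat, x = a%:A * s2 + b%:A * (s1 * s2).
Proof.
have [a [b [c [d ->]]]] := biquadratic_repr x.
rewrite -/(comb a b c d) tauE => /eqP; rewrite eq_sym eqr_oppLR => /eqP e.
exists c, d; rewrite -[LHS]half_double {2}e.
have -> : comb a b c d - comb a b (- c) (- d) = 2 *: (c%:A * s2 + d%:A * (s1 * s2)).
  by rewrite scaler_nat /comb !scaleNr; ring.
by rewrite scalerA mulVf // scale1r.
Qed.

Lemma antifixed_sigma x : sigma x = - x -> exists a b : rat, x = a%:A * s1 + b%:A * (s1 * s2).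
Proof.
have [a [b [c [d ->]]]] := biquadratic_repr x.
rewrite -/(comb a b c d) sigmaE => /eqP; rewrite eq_sym eqr_oppLR => /eqP e.
exists b, d; rewrite -[LHS]half_double {2}e.
have -> : comb a b c d - comb a (- b) c (- d) = 2 *: (b%:A * s1 + d%:A * (s1 * s2)).
  by rewrite scaler_nat /comb !scaleNr; ring.
by rewrite scalerA mulVf // scale1r.
Qed.

Lemma antifixed_sigma_tau x : sigma (tau x) = - x -> exists a b : rat, x = a%:A * s1 + b%:A * s2.
Proof.
have [a [b [c [d ->]]]] := biquadratic_repr x.
rewrite -/(comb a b c d) tauE sigmaE !opprK => /eqP; rewrite eq_sym eqr_oppLR => /eqP e.
exists b, c; rewrite -[LHS]half_double {2}e.
have -> : comb a b c d - comb a (- b) (- c) d = 2 *: (b%:A * s1 + c%:A * s2).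
  by rewrite scaler_nat /comb !scaleNr; ring.
by rewrite scalerA mulVf // scale1r.
Qed.

End Biquadratic.

(* [m] and [m'] are [(u + w) ^+ 2] and [(u - w) ^+ 2], whose difference is [4 * u * w]. *)
Lemma conjugate_units_near4 (K : splittingFieldType rat) (a b x y : rat) (s t u w : K) :
  0 < a -> 0 < b -> (forall q : rat, q ^+ 2 != a) -> (forall q : rat, q ^+ 2 != b) ->
  s ^+ 2 = a%:A -> t ^+ 2 = b%:A ->
  u = x%:A * s + y%:A * t -> w = x%:A * s - y%:A * t ->
  integralOver (intr : int -> K) u -> integralOver (intr : int -> K) w ->
  u * w = 1 \/ u * w = -1 -> near4 a b.
Proof.
move=> a0 b0 na nb sa tb uE wE uI wI uw.
have AE (q : rat) : (q%:A : K) = in_alg K q by [].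
have uwE : u * w = (x ^+ 2 * a - y ^+ 2 * b)%:A.
  by rewrite AE rmorphB !rmorphM /= -sa -tb uE wE; ring.
have [m em] : exists m : int, x ^+ 2 * (4 * a) = m%:~R.
  apply: (@integral_rat_int K).
  have -> : (x ^+ 2 * (4 * a))%:A = (u + w) * (u + w) :> K.
    rewrite AE !rmorphM rmorph_nat /= -sa uE wE; ring.
  by apply: integral_mul; apply: integral_add.
have [m' em'] : exists m : int, y ^+ 2 * (4 * b) = m%:~R.
  apply: (@integral_rat_int K).
  have -> : (y ^+ 2 * (4 * b))%:A = (u - w) * (u - w) :> K.
    rewrite AE !rmorphM rmorph_nat /= -tb uE wE; ring.
  by apply: integral_mul; apply: integral_sub.
have ab : x ^+ 2 * a - y ^+ 2 * b = 1 \/ x ^+ 2 * a - y ^+ 2 * b = -1.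
  by case: uw; rewrite uwE AE => e; [left|right];
    apply/(@fmorph_inj _ _ (in_alg K))/(etrans e); rewrite ?rmorphN rmorph1.
(* With [x = 0] the relation [ab] forces [y ^+ 2 * b = 1], so that [b] would be a rational square.
   The case of [y] is symmetric. *)
have x0 : x != 0.
  apply/eqP => x0; have y0 : y != 0.
    by apply/eqP => y0; move: ab; rewrite x0 y0 expr0n /= !mul0r subr0 => -[] /eqP.
  have := nb y^-1; rewrite exprVn => /eqP[]; apply: (mulfI (expf_neq0 2 y0)).
  rewrite mulfV ?expf_neq0 //; have : 0 < y ^+ 2 * b by rewrite mulr_gt0 // exprn_even_gt0.
  by case: ab; rewrite x0 expr0n mul0r /=; lra.
have y0 : y != 0.
  apply/eqP => y0.
  have := na x^-1; rewrite exprVn => /eqP[]; apply: (mulfI (expf_neq0 2 x0)).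
  rewrite mulfV ?expf_neq0 //; have : 0 < x ^+ 2 * a by rewrite mulr_gt0 // exprn_even_gt0.
  by case: ab; rewrite y0 expr0n mul0r /=; lra.
have m0 : 0 <= m.
  by rewrite -(ler0z rat) -em mulr_ge0 ?sqr_ge0 // mulr_ge0 // ltW.
have m'0 : 0 <= m'.
  by rewrite -(ler0z rat) -em' mulr_ge0 ?sqr_ge0 // mulr_ge0 // ltW.
have mm : m = m' + 4 \/ m' = m + 4.
  by case: ab => e; [left|right]; apply: (@intr_inj rat); rewrite intrD -em -em'; lra.
(* The factors 2 come from [u + w = 2 * x * s] and [u - w = 2 * y * t]. *)
exists (2 * x), (2 * y), `|m|%N, `|m'|%N; split; last by lia.
- by rewrite !mulf_neq0.
- by rewrite natr_absz ger0_norm // -em; ring.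
- by rewrite natr_absz ger0_norm // -em'; ring.
Qed.

(** * The log-unit lattice *)

Lemma ord3P (Q : 'I_3 -> Prop) :
  Q ord0 -> Q (lift ord0 ord0) -> Q (lift ord0 (lift ord0 ord0)) -> forall k, Q k.
Proof.
move=> q0 q1 q2 [[|[|[|//]]] i].
- by rewrite (_ : Ordinal i = ord0) //; apply: val_inj.
- by rewrite (_ : Ordinal i = lift ord0 ord0) //; apply: val_inj.
- by rewrite (_ : Ordinal i = lift ord0 (lift ord0 ord0)) //; apply: val_inj.
Qed.

Section Logs.
Variables (R : realType) (K : splittingFieldType rat) (iota : {rmorphism K -> R}).
Implicit Types x y : K.

Definition lnabs x : R := ln `|iota x|.

Let pos x : x != 0 -> `|iota x| \is Num.pos.
Proof. by move=> x0; rewrite posrE normr_gt0 fmorph_eq0. Qed.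

Lemma lnabsM x y : x != 0 -> y != 0 -> lnabs (x * y) = lnabs x + lnabs y.
Proof. by move=> x0 y0; rewrite /lnabs rmorphM normrM lnM ?pos. Qed.

Lemma lnabs1 : lnabs 1 = 0.
Proof. by rewrite /lnabs rmorph1 normr1 ln1. Qed.

Lemma lnabsN x : lnabs (- x) = lnabs x.
Proof. by rewrite /lnabs rmorphN normrN. Qed.

Lemma lnabsV x : x != 0 -> lnabs x^-1 = - lnabs x.
Proof. by move=> x0; rewrite /lnabs fmorphV normfV lnV ?pos. Qed.

Lemma lnabsX x n : x != 0 -> lnabs (x ^+ n) = lnabs x *+ n.
Proof. by move=> x0; rewrite /lnabs rmorphXn normrX lnXn // -posrE pos. Qed.

Lemma lnabsXz x (z : int) : x != 0 -> lnabs (x ^ z) = z%:~R * lnabs x.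
Proof.
move=> x0; case: z => n; first by rewrite -exprnP lnabsX // mulr_natl.
by rewrite NegzE -exprnN lnabsV ?expf_neq0 // lnabsX // mulrNz mulNr mulr_natl.
Qed.

Lemma lnabs_inj x y : x != 0 -> y != 0 -> lnabs x = lnabs y -> x = y \/ x = - y.
Proof.
move=> x0 y0 /(ln_inj (pos x0) (pos y0)) /eqP; rewrite eqr_norm2.
by case/orP => /eqP e; [left|right]; apply: (fmorph_inj iota); rewrite e ?rmorphN.
Qed.

Lemma lnabs_eq0 x : x != 0 -> lnabs x = 0 -> x = 1 \/ x = -1.
Proof.
by move=> x0 e; apply: lnabs_inj; rewrite ?oner_eq0 // lnabs1.
Qed.

Variables (d1 d2 : rat) (s1 s2 : K) (sigma tau : gal_of {:K}).
Hypothesis hK : real_biquadratic d1 d2 s1 s2 sigma tau.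

Let U := @integer_units K {:K}%AS.
Let LOG := Log iota sigma tau.

(* The nontrivial automorphism fixing the [k]-th quadratic subfield. *)
Definition fix3 (k : 'I_3) x : K := [:: tau x; sigma x; sigma (tau x)]`_k.

Let fixK k x : fix3 k (fix3 k x) = x.
Proof.
elim/ord3P: k; rewrite /fix3 /=; [exact: tauK hK x|exact: sigmaK hK x|].
by rewrite (tau_sigma hK) (tauK hK) (sigmaK hK).
Qed.

Let fixM k : {morph fix3 k : x y / x * y}.
Proof. by elim/ord3P: k => x y; rewrite /fix3 /= !rmorphM. Qed.

Let fix1 k : fix3 k 1 = 1.
Proof. by elim/ord3P: k; rewrite /fix3 /= !rmorph1. Qed.

Let fixN k x : fix3 k (- x) = - fix3 k x.
Proof. by elim/ord3P: k; rewrite /fix3 /= !rmorphN. Qed.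

Let fixV k x : fix3 k x^-1 = (fix3 k x)^-1.
Proof. by elim/ord3P: k; rewrite /fix3 /= !fmorphV. Qed.

Let fixXz k x (z : int) : fix3 k (x ^ z) = fix3 k x ^ z.
Proof. by elim/ord3P: k; rewrite /fix3 /= !fmorphXz. Qed.

Let fixD k : {morph fix3 k : x y / x + y}.
Proof. by elim/ord3P: k => x y; rewrite /fix3 /= !rmorphD. Qed.

Let fixQ k (a : rat) : fix3 k a%:A = a%:A.
Proof. by elim/ord3P: k; rewrite /fix3 /= !galQ. Qed.

Let fixU k x : U x -> U (fix3 k x).
Proof. by elim/ord3P: k => ux; rewrite /fix3 /=; do ?apply: integer_units_gal. Qed.

Let fixC k l x : fix3 k (fix3 l x) = fix3 l (fix3 k x).
Proof.
by elim/ord3P: k; elim/ord3P: l; rewrite /fix3 /= ?(tau_sigma hK) // ?(tauK hK) ?(sigmaK hK).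
Qed.

(** Any two of the three involutions generate the Galois group. *)
Let fix_rational k l x : k != l -> fix3 k x = x -> fix3 l x = x ->
  exists q : rat, x = q%:A.
Proof.
move=> kl ek el; suff [] : tau x = x /\ sigma x = x by exact: fixed_rational hK x.
wlog lt : k l kl ek el / (k < l)%N.
  move=> W; have [kl'|lk|/val_inj e] := ltngtP k l; first exact: (W k l).
    by apply: (W l k); rewrite // eq_sym.
  by rewrite e eqxx in kl.
have e02 : tau x = x -> sigma (tau x) = x -> sigma x = x by move=> ->.
have e12 : sigma x = x -> sigma (tau x) = x -> tau x = x.
  by move=> e; rewrite -(tau_sigma hK) e.
move: lt ek el; clear kl; elim/ord3P: k; elim/ord3P: l => // _; rewrite /fix3 /= => e1 e2.
- by split=> //; exact: e02.
- by split=> //; exact: e12.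
Qed.

(* On vectors of coordinate sum zero, twice the coordinate along the line spanned by the
   logarithms of the units of the [k]-th quadratic subfield. *)
Definition axis (k : 'I_3) (v : 'rV[R]_4) : R := v 0 ord0 + v 0 (lift ord0 k).

Let axisD k (u v : 'rV[R]_4) : axis k (u + v) = axis k u + axis k v.
Proof. by rewrite /axis !mxE; ring. Qed.

Let axisZ k a v : axis k (a *: v) = a * axis k v.
Proof. by rewrite /axis !mxE mulrDr. Qed.

Let axisN k v : axis k (- v) = - axis k v.
Proof. by rewrite /axis !mxE opprD. Qed.

Let axis_sum k (I : finType) (F : I -> 'rV[R]_4) :
  axis k (\sum_i F i) = \sum_i axis k (F i).
Proof.
apply: (big_morph (axis k)); first exact: axisD.
by rewrite /axis !mxE addr0.
Qed.

(** * The [Log] map in the coordinates given by the three lines *)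

Let LogE x : LOG x = \row_j (if unlift ord0 j is Some k then lnabs (fix3 k x) else lnabs x).
Proof.
apply/rowP => -[[|[|[|[|//]]]] i]; rewrite !mxE /=.
- by rewrite (_ : Ordinal i = ord0) ?unlift_none //; apply: val_inj.
- by rewrite (_ : Ordinal i = lift ord0 ord0) ?liftK //; apply: val_inj.
- by rewrite (_ : Ordinal i = lift ord0 (lift ord0 ord0)) ?liftK //; apply: val_inj.
- by rewrite (_ : Ordinal i = lift ord0 (lift ord0 (lift ord0 ord0))) ?liftK //; apply: val_inj.
Qed.

Let Log0E x : LOG x 0 ord0 = lnabs x.
Proof. by rewrite LogE mxE unlift_none. Qed.

Let LogSE k x : LOG x 0 (lift ord0 k) = lnabs (fix3 k x).
Proof. by rewrite LogE mxE liftK. Qed.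

Let axis_Log k x : axis k (LOG x) = lnabs x + lnabs (fix3 k x).
Proof. by rewrite /axis Log0E LogSE. Qed.

Let U0 x : U x -> x != 0.
Proof. exact: integer_units_neq0. Qed.

Let LogM x y : U x -> U y -> LOG (x * y) = LOG x + LOG y.
Proof.
move=> ux uy; apply/rowP => j; rewrite !LogE !mxE.
by case: unliftP => [k|] _; rewrite ?fixM lnabsM //; apply: U0 => //; apply: fixU.
Qed.

Let LogXz x (z : int) : U x -> LOG (x ^ z) = z%:~R *: LOG x.
Proof.
move=> ux; apply/rowP => j; rewrite !LogE !mxE.
by case: unliftP => [k|] _; rewrite ?fixXz lnabsXz //; apply: U0 => //; apply: fixU.
Qed.

(** The product of the four conjugates is a rational unit, hence 1 or -1. *)
Let Log_sum0 x : U x -> LOG x 0 ord0 + \sum_k LOG x 0 (lift ord0 k) = 0.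
Proof.
move=> ux; pose n := x * tau x * (sigma x * sigma (tau x)).
have ut : U (tau x) by exact: integer_units_gal.
have us : U (sigma x) by exact: integer_units_gal.
have ust : U (sigma (tau x)) by exact: integer_units_gal.
have un : U n by do !apply: integer_unitsM.
have [q nq] : exists q : rat, n = q%:A.
  apply: (fixed_rational hK); rewrite /n !rmorphM /= ?(tau_sigma hK) ?(tauK hK) ?(sigmaK hK).
    by rewrite [tau x * x]mulrC [sigma (tau x) * _]mulrC.
  by rewrite mulrC.
have n1 : lnabs n = 0.
  by move: un; rewrite nq => /rational_unit [->|->]; rewrite ?lnabsN lnabs1.
rewrite !big_ord_recl big_ord0 Log0E !LogSE /fix3 /=.
by move: n1; rewrite /n !lnabsM ?mulf_neq0 ?U0 //; lra.
Qed.

(** Parseval on the hyperplane of coordinate sum zero, for the orthogonal vectors [(1, 1, -1, -1)],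
    [(1, -1, 1, -1)], [(1, -1, -1, 1)]. *)
Let dot_Log x y : U x -> U y ->
  dotv (LOG x) (LOG y) = \sum_k axis k (LOG x) * axis k (LOG y).
Proof.
move=> ux uy; have := Log_sum0 ux; have := Log_sum0 uy.
rewrite /dotv /axis !big_ord_recl !big_ord0.
move: (LOG x) (LOG y) => a b e1 e2.
have -> : b 0 ord0 = - (b 0 (lift ord0 ord0) + b 0 (lift ord0 (lift ord0 ord0))
   + b 0 (lift ord0 (lift ord0 (lift ord0 ord0)))) by lra.
have -> : a 0 ord0 = - (a 0 (lift ord0 ord0) + a 0 (lift ord0 (lift ord0 ord0))
   + a 0 (lift ord0 (lift ord0 (lift ord0 ord0)))) by lra.
ring.
Qed.

(** For [l != k], [fix3 k] exchanges [x * fix3 l x] with the product of the two remaining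
    conjugates, whose logarithm is the opposite one. *)
Let axis_fix k l x : U x ->
  axis l (LOG (fix3 k x)) = (if l == k then 1 else -1) * axis l (LOG x).
Proof.
move=> ux; have := Log_sum0 ux; rewrite !big_ord_recl big_ord0 Log0E !LogSE !axis_Log.
have tx := tauK hK x; have sx := sigmaK hK x; have ts := tau_sigma hK x.
have stx := sigmaK hK (tau x); have tst : tau (sigma (tau x)) = sigma x.
  by rewrite (tau_sigma hK) (tauK hK).
elim/ord3P: k; elim/ord3P: l; rewrite /fix3 /= ?tx ?ts ?stx ?tst ?sx; lra.
Qed.

Let axis_eq0 x : U x -> (forall k, axis k (LOG x) = 0) -> LOG x = 0.
Proof.
move=> ux h; apply/eqP/negPn/negP => /dotv_gt0.
by rewrite dot_Log // big1 ?ltxx // => k _; rewrite h mul0r.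
Qed.

Let axis_inj x y : U x -> U y ->
  (forall k, axis k (LOG x) = axis k (LOG y)) -> LOG x = LOG y.
Proof.
move=> ux uy h; have uV := integer_unitsV uy.
have LV : LOG y^-1 = - LOG y by rewrite -exprN1 LogXz // mulrN1z scaleN1r.
have : LOG (x * y^-1) = 0.
  apply: axis_eq0 => [|k]; first exact: integer_unitsM.
  by rewrite LogM // LV axisD axisN h subrr.
by rewrite LogM // LV => /eqP; rewrite subr_eq0 => /eqP.
Qed.

Let on_axis k (v : 'rV[R]_4) := forall l, l != k -> axis l v = 0.

Let lnabs_fixed2 k l x : U x -> k != l -> fix3 k x = x -> fix3 l x = x -> lnabs x = 0.
Proof.
move=> ux kl ek el; have [q e] := fix_rational kl ek el.
by move: ux; rewrite e => /rational_unit[] ->; rewrite ?lnabsN lnabs1.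
Qed.

(** The relative norm [x * fix3 l x] is fixed by both [fix3 l] and [fix3 k], hence is a rational
    unit. *)
Let fixed_on_axis k x : U x -> fix3 k x = x -> on_axis k (LOG x).
Proof.
move=> ux e l lk; rewrite axis_Log -lnabsM ?U0 //; last exact: fixU.
apply: (lnabs_fixed2 (k := k) (l := l)); rewrite 1?eq_sym //.
- by apply: integer_unitsM => //; exact: fixU.
- by rewrite fixM fixC e.
- by rewrite fixM fixK mulrC.
Qed.

Let on_axis_fix k x : U x -> on_axis k (LOG x) -> fix3 k x = x \/ fix3 k x = - x.
Proof.
move=> ux h; apply: lnabs_inj; rewrite ?U0 //; first exact: fixU.
rewrite -!Log0E; suff -> : LOG (fix3 k x) = LOG x by [].
apply: axis_inj => // [|l]; first exact: fixU.
by rewrite axis_fix //; case: eqVneq => [_|/h ->]; rewrite ?mul1r // mulr0.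
Qed.

(* The equality makes a relative norm to one quadratic subfield equal, up to sign and
   inversion, to a relative norm to another one, hence rational. *)
Let axis_sqr_eq k l x : U x -> k != l ->
  axis k (LOG x) ^+ 2 = axis l (LOG x) ^+ 2 -> axis k (LOG x) = 0.
Proof.
move=> ux kl; pose n j := x * fix3 j x.
have un j : U (n j) by apply: integer_unitsM => //; exact: fixU.
have nn j : fix3 j (n j) = n j by rewrite fixM fixK mulrC.
have axE j : axis j (LOG x) = lnabs (n j).
  by rewrite axis_Log lnabsM ?U0 //; exact: fixU.
rewrite !axE => /eqP; rewrite eqf_sqr => h.
have fl : fix3 l (n k) = n k.
  case/orP: h => /eqP; last rewrite -lnabsV ?U0 //.
    by case/lnabs_inj; rewrite ?U0 // => ->; rewrite ?fixN nn.
  by case/lnabs_inj; rewrite ?invr_eq0 ?U0 // => ->; rewrite ?fixN fixV nn.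
by apply: (lnabs_fixed2 (un k) kl).
Qed.

(** * Nonzero vectors on the three lines, and the exclusion of three square roots *)

Let pell_unit k l (d : rat) (s : K) : 0 < d -> (forall q : rat, q ^+ 2 != d) ->
  s ^+ 2 = d%:A -> k != l -> fix3 k s = s -> fix3 l s = - s ->
  exists u, [/\ U u, fix3 k u = u & axis k (LOG u) != 0].
Proof.
move=> d0 nd sd kl ks ls.
have [N [q [N0 q0 dN]]] := rat_sqr_class d0.
have qn0 : q%:R != 0 :> rat by rewrite pnatr_eq0 -lt0n.
have [x [y [y0 xy]]] : exists x y : int, y != 0 /\ x ^+ 2 - N%:R * y ^+ 2 = 1.
  apply: (pell R) => c cN; have := nd (c%:R / q%:R).
  by rewrite expr_div_n -natrX cN -dN mulfK ?eqxx // expf_neq0.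
(* As [N = d * q ^+ 2], a square root of [N] is [q * s], and the Pell solution becomes the unit
   [x + y * q * s]. *)
pose a : rat := x%:~R; pose b : rat := y%:~R * q%:R.
have b0 : b != 0 by rewrite mulf_neq0 // intr_eq0.
have bE : b ^+ 2 * d = N%:R * y%:~R ^+ 2 by rewrite /b -dN; ring.
have [M bd] : exists M : int, b ^+ 2 * d = M%:~R.
  by exists (N%:R * y ^+ 2); rewrite bE intrM natz rmorphXn.
have ab : a ^+ 2 - b ^+ 2 * d = 1.
  by have := congr1 (intr : int -> rat) xy; rewrite bE intrB intrM natz !rmorphXn.
have bs2 : (b%:A * s) ^+ 2 = (b ^+ 2 * d)%:A.
  by rewrite exprMn sd -[_%:A]/(in_alg K b) -[d%:A]/(in_alg K d) -rmorphXn -rmorphM.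
have as2 : (a%:A : K) ^+ 2 = (a ^+ 2)%:A.
  by rewrite -[_%:A]/(in_alg K a) -rmorphXn.
have aI : integralOver (intr : int -> K) a%:A.
  by rewrite -[_%:A]/(in_alg K _) rmorph_int; exact: integral_id.
have bI : integralOver (intr : int -> K) (b%:A * s).
  exists ('X^2 - M%:P); first by rewrite monicXnsubC.
  rewrite rmorphB /= map_polyXn map_polyC rootE !hornerE bs2 bd.
  by rewrite -[_%:A]/(in_alg K _) rmorph_int subrr.
have prod1 : (a%:A + b%:A * s) * (a%:A - b%:A * s) = 1.
  by rewrite mulrC -subr_sqr bs2 as2 -scalerBl ab scale1r.
exists (a%:A + b%:A * s); split; last 1 first.
- rewrite axis_Log !(fixD, fixM, fixQ) ks -mulr2n mulrn_eq0 /=.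
  have u0 : a%:A + b%:A * s != 0.
    by apply/eqP => e; move/eqP: prod1; rewrite e mul0r eq_sym oner_eq0.
  (* Otherwise the unit is 1 or -1 and is fixed by [fix3 l], which negates the nonzero term
     [b%:A * s]. *)
  apply/eqP => /(lnabs_eq0 u0) h.
  have : fix3 l (a%:A + b%:A * s) = a%:A + b%:A * s by case: h => ->; rewrite ?fixN fix1.
  rewrite !(fixD, fixM, fixQ) ls mulrN => /addrI /eqP.
  rewrite -subr_eq0 -opprD oppr_eq0 -mulr2n -[_ *+ 2](scaler_nat 2) scaler_eq0 /=.
  rewrite mulf_eq0 scaler_eq0 oner_eq0 orbF (negbTE b0) /= => /eqP s0.
  by have := nd 0; rewrite expr0n /=; move/eqP: sd;
    rewrite s0 expr0n eq_sym scaler_eq0 oner_eq0 orbF eq_sym => ->.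
- split; first by split; [exact: memvf|exact: integral_add].
  by exists (a%:A - b%:A * s) => //; split; [exact: memvf|exact: integral_sub].
- by rewrite !(fixD, fixM, fixQ) ks.
Qed.

Let axis_unit k : exists u, [/\ U u, fix3 k u = u & axis k (LOG u) != 0].
Proof.
case: hK => [[d10 d20] nsq [e1 e2 _] [g1 g2] [t1 t2]].
elim/ord3P: k.
- apply: (@pell_unit _ (lift ord0 ord0) d1 s1) => // q; by have [] := nsq q.
- apply: (@pell_unit _ ord0 d2 s2) => // q; by have [] := nsq q.
- apply: (@pell_unit _ ord0 (d1 * d2) (s1 * s2)); rewrite /fix3 //= ?mulr_gt0 //.
  + by move=> q; have [] := nsq q.
  + by rewrite exprMn e1 e2 -scalerAl mul1r scalerA.
  + by rewrite !rmorphM /= t1 t2 !rmorphN /= g1 g2 mulrNN.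
  + by rewrite rmorphM /= t1 t2 mulrN.
Qed.

Let not_three_square_roots (w : 'I_3 -> K) : (forall k, U (w k)) ->
  (forall k, on_axis k (LOG (w k))) -> (forall k, fix3 k (w k) = - w k) -> False.
Proof.
move=> uw ow fw; case: hK => [[d10 d20] nsq [e1 e2 _] [g1 g2] [t1 t2]].
have I x : U x -> integralOver (intr : int -> K) x by move=> [[]].
have n1 (q : rat) : q ^+ 2 != d1 by have [] := nsq q.
have n2 (q : rat) : q ^+ 2 != d2 by have [] := nsq q.
have n3 (q : rat) : q ^+ 2 != d1 * d2 by have [] := nsq q.
have e3 : (s1 * s2) ^+ 2 = (d1 * d2)%:A.
  by rewrite exprMn e1 e2 -scalerAl mul1r scalerA.
have d30 : 0 < d1 * d2 by rewrite mulr_gt0.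
(* Since [LOG (w k)] lies on the [k]-th line, the relative norm of [w k] to another subfield has
   logarithm 0. *)
have pm k l : l != k -> w k * fix3 l (w k) = 1 \/ w k * fix3 l (w k) = -1.
  move=> lk; have u' := fixU l (uw k); apply: lnabs_eq0.
    by rewrite mulf_neq0 ?U0.
  by rewrite lnabsM ?U0 // -axis_Log ow.
have P k l (x y a b : rat) (s t : K) : l != k -> 0 < a -> 0 < b ->
    (forall q : rat, q ^+ 2 != a) -> (forall q : rat, q ^+ 2 != b) ->
    s ^+ 2 = a%:A -> t ^+ 2 = b%:A -> w k = x%:A * s + y%:A * t ->
    fix3 l s = s -> fix3 l t = - t -> near4 a b.
  move=> lk a0 b0 na nb sa tb wE ls lt.
  apply: (conjugate_units_near4 a0 b0 na nb sa tb wE _ _ _ (pm k l lk)).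
  - by rewrite wE fixD !fixM !fixQ ls lt mulrN.
  - by apply: I.
  - by apply: I; apply: fixU.
apply: (near4_sqr_classes d10 d20 nsq).
- have [x [y e]] := antifixed_tau hK (fw ord0).
  apply: (P ord0 (lift ord0 ord0) _ _ _ _ _ _ _ _ _ _ _ _ _ e) => //.
  by rewrite /fix3 /= rmorphM /= g1 g2 mulNr.
- have [x [y e]] := antifixed_sigma hK (fw (lift ord0 ord0)).
  apply: (P (lift ord0 ord0) ord0 _ _ _ _ _ _ _ _ _ _ _ _ _ e) => //.
  by rewrite /fix3 /= rmorphM /= t1 t2 mulrN.
- have [x [y e]] := antifixed_sigma_tau hK (fw (lift ord0 (lift ord0 ord0))).
  exact: (P (lift ord0 (lift ord0 ord0)) ord0 _ _ _ _ _ _ _ _ _ _ _ _ _ e).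
Qed.

(** * The involutions as permutations of the four coordinates, and the basis along the three
    lines *)

Let perm4 (k : 'I_3) (j : 'I_4) : 'I_4 :=
  inord (nth 0 (nth [::] [:: [:: 1; 0; 3; 2]; [:: 2; 3; 0; 1]; [:: 3; 2; 1; 0]] k) j)%N.

Let perm4K k : involutive (perm4 k).
Proof.
by elim/ord3P: k => -[[|[|[|[|//]]]] i]; apply: val_inj; rewrite /perm4 /= !inordK //= ?inordK.
Qed.

Let Log_perm4 k x j : LOG (fix3 k x) 0 j = LOG x 0 (perm4 k j).
Proof.
have tx := tauK hK x; have sx := sigmaK hK x; have ts := tau_sigma hK x.
have stx := sigmaK hK (tau x); have tst : tau (sigma (tau x)) = sigma x.
  by rewrite (tau_sigma hK) (tauK hK).
by elim/ord3P: k; case: j => -[|[|[|[|//]]]] i; rewrite !mxE /perm4 /= inordK //= /fix3 /=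
  ?tx ?ts ?stx ?tst ?sx.
Qed.

(** The symmetric involutive matrix to which [orthogonal_basis_involution] is applied. *)
Let perm4_mx k := perm_mx (perm (inv_inj (@perm4K k))) : 'M[R]_4.

Let perm4V k : (perm (inv_inj (@perm4K k)))^-1%g = perm (inv_inj (@perm4K k)).
Proof.
apply/eqP; rewrite eq_invg_mul; apply/eqP/permP => j.
by rewrite permM !permE perm4K.
Qed.

Let Log_perm4_mx k x : LOG x *m perm4_mx k = LOG (fix3 k x).
Proof.
rewrite /perm4_mx -perm4V -col_permE; apply/rowP => j.
by rewrite [LHS]mxE permE -Log_perm4.
Qed.

(** The second and third clauses put nonzero vectors on distinct orthogonal lines, whence linear
    independence. *)
Let axis_basis (w : 'I_3 -> K) := [/\ forall k, U (w k),
  forall k, on_axis k (LOG (w k)), forall k, axis k (LOG (w k)) != 0 &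
  forall x, U x -> exists z : 'I_3 -> int, LOG x = \sum_k (z k)%:~R *: LOG (w k)].

(** With exactly one zero coordinate, the first alternative equates the squares of the two others,
    which [sq] forbids. With none, it holds for [i0] and [i1], and adding the two equations kills
    [p i2]. *)
Let two_zero (p : 'I_3 -> R) :
  (forall k l, k != l -> p k ^+ 2 = p l ^+ 2 -> p k = 0) ->
  (forall k, [\/ \sum_l (if l == k then 1 else -1) * p l ^+ 2 = 0,
                 forall l, l != k -> p l = 0 | p k = 0]) ->
  exists k, forall l, l != k -> p l = 0.
Proof.
pose i0 : 'I_3 := ord0; pose i1 : 'I_3 := lift ord0 ord0.
pose i2 : 'I_3 := lift ord0 (lift ord0 ord0).
move=> sq h.
have [p0|p0] := eqVneq (p i0) 0; have [p1|p1] := eqVneq (p i1) 0;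
  have [p2|p2] := eqVneq (p i2) 0.
- by exists i0; elim/ord3P.
- by exists i2; elim/ord3P.
- by exists i1; elim/ord3P.
- exfalso; case: (h i1) => [|/(_ i2 isT)|]; try by apply/eqP.
  rewrite !big_ord_recl big_ord0 /= -/i0 -/i1 -/i2 p0 => e.
  by move/eqP: p1; apply; apply: (sq i1 i2) => //; lra.
- by exists i0; elim/ord3P.
- exfalso; case: (h i0) => [|/(_ i2 isT)|]; try by apply/eqP.
  rewrite !big_ord_recl big_ord0 /= -/i0 -/i1 -/i2 p1 => e.
  by move/eqP: p0; apply; apply: (sq i0 i2) => //; lra.
- exfalso; case: (h i0) => [|/(_ i1 isT)|]; try by apply/eqP.
  rewrite !big_ord_recl big_ord0 /= -/i0 -/i1 -/i2 p2 => e.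
  by move/eqP: p0; apply; apply: (sq i0 i1) => //; lra.
- exfalso; case: (h i0) => [|/(_ i1 isT)|]; try by apply/eqP.
  case: (h i1) => [|/(_ i0 isT)|]; try by move/eqP => e _; move: e; apply/negP.
  rewrite !big_ord_recl !big_ord0 /= -/i0 -/i1 -/i2 => e e'.
  by move/eqP: p2; apply; apply/eqP; rewrite -sqrf_eq0; apply/eqP; lra.
Qed.

Lemma orthogonal_axis_basis :
  orthogonal_lattice (log_unit_lattice iota sigma tau) -> exists w, axis_basis w.
Proof.
case=> n [B [[fB LB] oB]].
have LU x : U x -> zspan B (LOG x) by move=> ux; rewrite -LB; exists x.
have rowL i : exists x, U x /\ LOG x = row i B.
  have : zspan B (row i B).
    by exists (delta_mx 0 i); rewrite map_delta_mx -rowE.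
  by rewrite -LB => -[x ux e]; exists x.
have [u uP] := choice rowL.
have uU i : U (u i) by case: (uP i).
have uE i : LOG (u i) = row i B by case: (uP i).
have u0 i : LOG (u i) != 0 by rewrite uE row_free_row_neq0.
have ax i : exists k, on_axis k (LOG (u i)).
  apply: (@two_zero (axis^~ (LOG (u i)))) => [k l kl|k]; first exact: axis_sqr_eq.
  have ui := uU i; have uf := fixU k ui.
  have [||j|||] := orthogonal_basis_involution fB oB _ _ _ i (T := perm4_mx k).
  - by rewrite tr_perm_mx perm4V.
  - by rewrite -perm_mxM -{1}perm4V mulVg perm_mx1.
  - by rewrite -uE Log_perm4_mx; apply/LU/fixU.
  - rewrite -uE Log_perm4_mx dot_Log // => e; apply: Or31; rewrite -[RHS]e.
    by apply: eq_bigr => l _; rewrite axis_fix //; case: ifP => _; ring.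
  - rewrite -uE Log_perm4_mx => e; apply: Or32 => l lk.
    by have := axis_fix k l ui; rewrite (negbTE lk) e; lra.
  - rewrite -uE Log_perm4_mx => e; apply: Or33.
    by have := axis_fix k k ui; rewrite eqxx e axisN; lra.
have [a aP] := choice ax.
have a0 i : axis (a i) (LOG (u i)) != 0.
  apply: contra_neq (u0 i) => e; apply: axis_eq0 => // k.
  by have [->|/aP] := eqVneq k (a i).
have ainj : injective a.
  move=> i j aij; apply/eqP/negPn/negP => ij; have := oB i j ij.
  rewrite -!uE dot_Log // (bigD1 (a i)) //= big1 => [|k ki]; last by rewrite aP // mul0r.
  by apply/eqP; rewrite addr0 mulf_neq0 // aij.
(* A Pell unit has a nonzero [k]-th coordinate, which some basis vector must supply. With [ainj],
   the basis is therefore indexed by the three lines. *)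
have asurj k : exists i, a i = k.
  have [x [ux _ xk]] := axis_unit k; have [z ze] := LU x ux.
  apply: contrapT => no; move/eqP: xk; apply.
  rewrite ze mulmx_sum_row axis_sum big1 // => i _.
  rewrite axisZ -uE aP ?mulr0 //; apply/eqP => e; apply: no; by exists i.
have [c cK] := choice asurj.
have aK : cancel a c by move=> i; apply: ainj.
exists (u \o c); split => [k|k|k|x ux] /=; first exact: uU.
- by have := aP (c k); rewrite cK.
- by have := a0 (c k); rewrite cK.
have [z ze] := LU x ux; exists (fun k => z 0 (c k)).
rewrite ze mulmx_sum_row (reindex c) /=; last by exists a => i _; rewrite ?cK.
by apply: eq_bigr => k _; rewrite mxE uE.
Qed.

(** Only logarithms matter: each [w k] may be replaced by a unit with the same [Log], and the order
    is free. *)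
Let axis_basis_system (w : 'I_3 -> K) (x1 x2 x3 : K) (i1 i2 i3 : 'I_3) :
  axis_basis w -> uniq [:: i1; i2; i3] -> U x1 -> U x2 -> U x3 ->
  LOG x1 = LOG (w i1) -> LOG x2 = LOG (w i2) -> LOG x3 = LOG (w i3) ->
  fundamental_system iota sigma tau x1 x2 x3.
Proof.
move=> [uw ow wn0 wspan] ui u1 u2 u3 e1 e2 e3.
pose p (j : 'I_3) := nth i1 [:: i1; i2; i3] j.
have pinj : injective p.
  by move=> i j /eqP; rewrite nth_uniq // => /eqP /val_inj.
split=> //; set M := \matrix_(_ < 3) _.
have rowM j : row j M = LOG (w (p j)).
  by elim/ord3P: j; rewrite rowK.
split.
  apply: inj_row_free => v vM; apply/rowP => j; rewrite mxE.
  have /eqP := congr1 (axis (p j)) vM.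
  rewrite mulmx_sum_row axis_sum (bigD1 j) //= big1 => [|i ij]; last first.
    rewrite axisZ rowM ow ?mulr0 //; apply: contra_neq ij => /pinj -> //.
  rewrite addr0 axisZ rowM [axis _ 0](_ : _ = 0) ?mulf_eq0 ?(negbTE (wn0 _)) ?orbF.
    by move/eqP.
  by rewrite /axis !mxE addr0.
have [q qK pK] := injF_bij pinj.
rewrite eqEsubset; split => v.
  case=> x ux <-; have [z ze] := wspan x ux.
  exists (\row_j z (p j)); rewrite -/LOG ze mulmx_sum_row (reindex p) /=; last first.
    by exists q => j _; rewrite ?qK ?pK.
  by apply: eq_bigr => j _; rewrite !mxE rowM.
case=> z ->.
exists (x1 ^ z 0 ord0 * (x2 ^ z 0 (lift ord0 ord0) * x3 ^ z 0 (lift ord0 (lift ord0 ord0)))).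
  by do !apply: integer_unitsM; apply: integer_unitsXz.
rewrite -/LOG !(LogM, LogXz) //; try by do ?[apply: integer_unitsM|apply: integer_unitsXz].
by rewrite mulmx_sum_row !big_ord_recl big_ord0 addr0 !rowM !mxE e1 e2 e3.
Qed.

(** * Fundamental units of the quadratic subfields *)

Let subfield3 (k : 'I_3) : {subfield K} :=
  nth <<1; s1>>%AS [:: <<1; s1>>%AS; <<1; s2>>%AS; <<1; s1 * s2>>%AS] k.

Let moved3 (k : 'I_3) : gal_of {:K} := nth sigma [:: sigma; tau; sigma] k.

Let fixed_subfield3 k x : (x \in subfield3 k) <-> fix3 k x = x.
Proof.
have [_ _ [e1 e2 _] [g1 g2] [t1 t2]] := hK.
have adj s l : fix3 l s = s -> s ^+ 2 \in (1%AS : {subfield K}) ->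
    x \in <<1; s>>%VS -> fix3 l x = x.
  move=> sl sE /(Fadjoin_sqrtP sE)[a [b [/vlineP[a' ->] /vlineP[b' ->] ->]]].
  by rewrite fixD fixM !fixQ sl.
elim/ord3P: k; rewrite /subfield3 /=; split.
- by apply: adj; rewrite // e1 rpredZ // mem1v.
- exact: fixed_tau hK x.
- by apply: adj; rewrite // e2 rpredZ // mem1v.
- exact: fixed_sigma hK x.
- apply: adj; first by rewrite /fix3 /= !rmorphM /= t1 t2 rmorphN /= g1 g2 mulrNN.
  by rewrite exprMn e1 e2 rpredM // rpredZ // mem1v.
- exact: fixed_sigma_tau hK x.
Qed.

Let units_subfield3 k x : integer_units (subfield3 k) x <-> U x /\ fix3 k x = x.
Proof.
split=> [/integer_unitsT[ux /fixed_subfield3 //]|[ux /fixed_subfield3 xE]].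
by apply/integer_unitsT.
Qed.

Let lnabs_moved3 k x : U x -> on_axis k (LOG x) -> lnabs (moved3 k x) = - lnabs x.
Proof.
move=> ux ox; suff [l lk ->] : exists2 l, l != k & moved3 k x = fix3 l x.
  by apply/eqP; rewrite -subr_eq0 opprK addrC -axis_Log ox.
by elim/ord3P: k ox => _; [exists (lift ord0 ord0)|exists ord0|exists (lift ord0 ord0)].
Qed.

(** On units of the subfield the second coordinate of [quad_Log] is the opposite of the first, so
    the first one decides. *)
Let fundamental_subfield3 k e : U e -> fix3 k e = e ->
  (forall x, U x -> fix3 k x = x -> exists z : int, lnabs x = z%:~R * lnabs e) ->
  fundamental_unit iota (subfield3 k) (moved3 k) e.
Proof.
move=> ue fe he; split; first exact/units_subfield3.
have qE x : U x -> fix3 k x = x ->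
    quad_Log iota (moved3 k) x = \row_(i < 2) [:: lnabs x; - lnabs x]`_i.
  move=> ux fx; apply/rowP => -[[|[|//]] i]; rewrite !mxE //=.
  by rewrite -/(lnabs _) lnabs_moved3 //; exact: fixed_on_axis.
have spanE (z : 'rV[int]_1) x : U x -> fix3 k x = x -> lnabs x = (z 0 0)%:~R * lnabs e ->
    quad_Log iota (moved3 k) x = map_mx intr z *m quad_Log iota (moved3 k) e.
  move=> ux fx ex; rewrite !qE //; apply/rowP => -[[|[|//]] i];
  by rewrite !mxE big_ord1 !mxE /= ex // mulrN.
rewrite eqEsubset; split => v.
  case=> x /units_subfield3[ux fx] <-; have [z ze] := he x ux fx.
  by exists (const_mx z); apply: spanE; rewrite // mxE.
case=> z ->; have uz := integer_unitsXz (z 0 0) ue.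
have fz : fix3 k (e ^ z 0 0) = e ^ z 0 0 by rewrite fixXz fe.
exists (e ^ z 0 0); first exact/units_subfield3.
by apply: spanE; rewrite // lnabsXz ?U0.
Qed.

(* If [Log (w k)] is the logarithm of a unit of the [k]-th quadratic subfield, that unit is
   fundamental; otherwise [w k ^+ 2] is. *)
Let subfield_unit (w : 'I_3 -> K) k : axis_basis w -> exists e,
  fundamental_unit iota (subfield3 k) (moved3 k) e /\
  (U e /\ LOG e = LOG (w k) \/ w k ^+ 2 = e /\ fix3 k (w k) = - w k).
Proof.
move=> [uw ow wn0 wspan].
have ax x : U x -> exists z : int, axis k (LOG x) = z%:~R * axis k (LOG (w k)).
  move=> ux; have [z ze] := wspan x ux; exists (z k).
  rewrite ze axis_sum (bigD1 k) //= big1 ?addr0 ?axisZ // => j jk.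
  by rewrite axisZ ow ?mulr0 // eq_sym.
have ax2 x : fix3 k x = x -> axis k (LOG x) = 2 * lnabs x.
  by move=> fx; rewrite axis_Log fx; ring.
have [[e [ue fe le]]|no] := pselect (exists e, [/\ U e, fix3 k e = e & LOG e = LOG (w k)]).
  exists e; split; last by left.
  apply: fundamental_subfield3 => // x ux fx; have [z] := ax x ux.
  by rewrite -le !ax2 // => h; exists z; lra.
have fw : fix3 k (w k) = - w k.
  case: (on_axis_fix (uw k) (ow k)) => // fw.
  by case: no; exists (w k).
have f2 : fix3 k (w k ^+ 2) = w k ^+ 2 by rewrite expr2 fixM fw mulrNN.
have axw : axis k (LOG (w k)) = 2 * lnabs (w k).
  by rewrite axis_Log fw lnabsN; ring.
exists (w k ^+ 2); split; last by right.
have uw2 : U (w k ^+ 2) := integer_unitsX 2 (uw k).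
apply: (fundamental_subfield3 uw2 f2).
move=> x ux fx; have [z] := ax x ux; rewrite ax2 // axw => h.
(* For even [z], [x] is up to sign a power of [w k ^+ 2]. For odd [z], dividing [x] by such a power
   leaves a unit of the subfield with the logarithm of [w k], against [no]. *)
have zE := divz_eq z 2; have z2 : (z %% 2)%Z = 0 \/ (z %% 2)%Z = 1 by lia.
rewrite lnabsX ?U0 //; case: z2 => r; rewrite r in zE.
  exists (z %/ 2)%Z; have zR : z%:~R = 2 * (z %/ 2)%Z%:~R :> R.
    by rewrite [in LHS]zE addr0 intrM mulrC.
  by move: h; rewrite zR; move: (z %/ 2)%Z%:~R => q h; nra.
case: no; exists (x * (w k ^+ 2) ^ (- (z %/ 2)%Z)).
have u2 : U ((w k ^+ 2) ^ (- (z %/ 2)%Z)) by exact: (integer_unitsXz _ uw2).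
have u3 : U (x * (w k ^+ 2) ^ (- (z %/ 2)%Z)) by exact: integer_unitsM.
have f3 : fix3 k (x * (w k ^+ 2) ^ (- (z %/ 2)%Z)) = x * (w k ^+ 2) ^ (- (z %/ 2)%Z).
  by rewrite fixM fixXz f2 fx.
split=> //; apply: axis_inj => // l.
have [->|lk] := eqVneq l k; last by rewrite ow // (fixed_on_axis u3 f3).
rewrite ax2 // axw lnabsM ?U0 // lnabsXz ?expf_neq0 ?U0 // lnabsX ?U0 //.
have zR : z%:~R = 2 * (z %/ 2)%Z%:~R + 1 :> R by rewrite [in LHS]zE intrD intrM mulrC.
by move: h; rewrite zR intrN; move: (z %/ 2)%Z%:~R => q h; nra.
Qed.

(** * The two implications *)

Lemma orthogonal_type_I :
  orthogonal_lattice (log_unit_lattice iota sigma tau) -> type_I iota s1 s2 sigma tau.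
Proof.
move=> /orthogonal_axis_basis[w wB]; have [uw ow wn0 _] := wB.
have [e eP] := choice (fun k => subfield_unit k wB).
pose i0 : 'I_3 := ord0; pose i1 : 'I_3 := lift ord0 ord0.
pose i2 : 'I_3 := lift ord0 (lift ord0 ord0).
have fund k := (eP k).1.
exists (e i0), (e i1), (e i2); split; try exact: (fund _).
pose S := axis_basis_system wB.
(* The cases record which [w k] are square roots of the fundamental units; a cyclic rotation puts
   these first. *)
case: (eP i0).2 => [[u0 l0]|[r0 f0]]; case: (eP i1).2 => [[u1 l1]|[r1 f1]];
  case: (eP i2).2 => [[u2 l2]|[r2 f2]].
- exists (e i0), (e i1), (e i2); split=> //; apply: Or31.
  exact: (S _ _ _ i0 i1 i2).
- exists (e i2), (e i0), (e i1); split; last apply: Or32.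
    by rewrite -(perm_rot 1).
  exists (w i2) => //; exact: (S _ _ _ i2 i0 i1).
- exists (e i1), (e i2), (e i0); split; last apply: Or32.
    by rewrite -(perm_rot 2).
  exists (w i1) => //; exact: (S _ _ _ i1 i2 i0).
- exists (e i1), (e i2), (e i0); split; last apply: Or33.
    by rewrite -(perm_rot 2).
  exists (w i1), (w i2); split=> //; exact: (S _ _ _ i1 i2 i0).
- exists (e i0), (e i1), (e i2); split=> //; apply: Or32.
  exists (w i0) => //; exact: (S _ _ _ i0 i1 i2).
- exists (e i2), (e i0), (e i1); split; last apply: Or33.
    by rewrite -(perm_rot 1).
  exists (w i2), (w i0); split=> //; exact: (S _ _ _ i2 i0 i1).
- exists (e i0), (e i1), (e i2); split=> //; apply: Or33.
  exists (w i0), (w i1); split=> //; exact: (S _ _ _ i0 i1 i2).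
- by case: (not_three_square_roots uw ow); elim/ord3P.
Qed.

Lemma type_I_orthogonal :
  type_I iota s1 s2 sigma tau -> orthogonal_lattice (log_unit_lattice iota sigma tau).
Proof.
case=> e1 [e2 [e3 [[f1 _] [f2 _] [f3 _] [a [b [c [abc typ]]]]]]].
have ax (k : 'I_3) : on_axis k (LOG (nth e1 [:: e1; e2; e3] k)).
  suff : integer_units (subfield3 k) (nth e1 [:: e1; e2; e3] k).
    by move/units_subfield3 => [ux fx]; exact: fixed_on_axis.
  by elim/ord3P: k.
(* [p] sends a position in the permuted list to the index of its quadratic subfield, hence to its
   line. *)
have [p pE] : exists p : {perm 'I_3},
    [:: a; b; c] = [seq tnth [tuple e1; e2; e3] (p i) | i <- enum 'I_3].
  by have /tuple_permP[p ->] : perm_eq [:: a; b; c] [tuple e1; e2; e3]; last by exists p.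
have axp (i : 'I_3) : on_axis (p i) (LOG (nth a [:: a; b; c] i)).
  by rewrite pE (nth_map i) ?size_enum_ord // nth_ord_enum (tnth_nth e1); exact: ax.
(* The logarithm of a power is a multiple of that of [r], so a square root stays on the line of its
   square. *)
have axX k r n : U r -> (0 < n)%N -> on_axis k (LOG (r ^+ n)) -> on_axis k (LOG r).
  move=> ur n0 h l lk; have := h l lk; rewrite exprnP LogXz // axisZ => /eqP.
  by rewrite mulf_eq0 intr_eq0 eqz_nat (gtn_eqF n0) /= => /eqP.
suff [x1 [x2 [x3 [fx h]]]] : exists x1 x2 x3, fundamental_system iota sigma tau x1 x2 x3 /\
    forall i : 'I_3, on_axis (p i) (LOG (nth a [:: x1; x2; x3] i)).
  case: fx => u1 u2 u3 bas; exists 3%N; eexists; split; first exact: bas.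
  have ux (i : 'I_3) : U (nth a [:: x1; x2; x3] i) by elim/ord3P: i.
  have rE (i : 'I_3) : row i (\matrix_(i < 3) LOG [:: x1; x2; x3]`_i) =
      LOG (nth a [:: x1; x2; x3] i) by rewrite rowK; elim/ord3P: i.
  move=> i j ij; rewrite !rE dot_Log // big1 // => k _.
  have [e|ki] := eqVneq k (p i); last by rewrite h // mul0r.
  by rewrite [X in _ * X]h ?mulr0 // e (inj_eq perm_inj).
case: typ => [fs|[r ra fs]|[r [t [ra tb fs]]]].
- by exists a, b, c.
- exists r, b, c; split=> //; elim/ord3P.
  + by case: fs => ur _ _ _; apply: (axX _ _ 2%N) => //=; rewrite ra; exact: (axp ord0).
  + exact: (axp (lift ord0 ord0)).
  + exact: (axp (lift ord0 (lift ord0 ord0))).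
- exists r, t, c; split=> //; elim/ord3P.
  + by case: fs => ur _ _ _; apply: (axX _ _ 2%N) => //=; rewrite ra; exact: (axp ord0).
  + by case: fs => _ ut _ _; apply: (axX _ _ 2%N) => //=; rewrite tb; exact: (axp (lift ord0 ord0)).
  + exact: (axp (lift ord0 (lift ord0 ord0))).
Qed.

End Logs.

Theorem theorem2p8 (R : realType) (K : splittingFieldType rat)
    (iota : {rmorphism K -> R}) (d1 d2 : rat) (s1 s2 : K)
    (sigma tau : gal_of {:K})
    (hK : real_biquadratic d1 d2 s1 s2 sigma tau) :
  orthogonal_lattice (log_unit_lattice iota sigma tau) <->
  type_I iota s1 s2 sigma tau.
Proof.
by split; [exact: orthogonal_type_I hK|exact: type_I_orthogonal hK].
Qed.
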